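(* Let $\eta,\sigma\in\{1,-1\}$, let $N\ge 0$ be an integer, let $\delta,\epsilon$ be real lattice parameters (grid sizes), let $\Gamma$ be a constant complex matrix of order $2N+2$ in Jordan canonical form, and let $T\in\mathbb{C}^{(2N+2)\times(2N+2)}$ be a constant matrix satisfying $$\Gamma T+\sigma T\Gamma^*=0,\qquad TT^*=\begin{cases}-\eta I,&\sigma=1,\\ \eta\,|e^{\Gamma^*}|^2 I,&\sigma=-1.\end{cases}$$ Let $C^{+}$ be a constant column vector of order $2N+2$ and let the $(2N+2)$-th order column vector $\Phi$ be given by $$\Phi=e^{\Gamma n}\big[(4+\delta\epsilon\coth\Gamma)(4-\delta\epsilon\coth\Gamma)^{-1}\big]^{m/2}C^+ .$$ Then the functions $$u=\frac gf,\qquad w=\frac{\widetilde f\,\widehat f}{f\,\widehat{\widetilde f}}$$ with $$f=|e^{-N\Gamma}\Phi,\,e^{(-N+2)\Gamma}\Phi,\dots,e^{N\Gamma}\Phi;\ e^{N\Gamma}T\Phi^*_\sigma,\,e^{(N-2)\Gamma}T\Phi^*_\sigma,\dots,e^{-N\Gamma}T\Phi^*_\sigma|,$$ $$g=\tfrac1\epsilon|e^{-N\Gamma}\Phi,\,e^{(-N+2)\Gamma}\Phi,\dots,e^{(N+2)\Gamma}\Phi;\ e^{N\Gamma}T\Phi^*_\sigma,\,e^{(N-2)\Gamma}T\Phi^*_\sigma,\dots,e^{(-N+2)\Gamma}T\Phi^*_\sigma|$$ solve the complex local ($\sigma=1$) and nonlocal ($\sigma=-1$) discrete sine-Gordon equation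 $$4\big(u+\widehat{\widetilde u}-(\widetilde u+\widehat u)w\big)=\delta\epsilon\big(u+\widehat{\widetilde u}+(\widetilde u+\widehat u)w\big),$$ $$(1+\eta\epsilon^2\,\widehat u\,\widehat u^*_\sigma)\,w=(1+\eta\epsilon^2\,u\,u^*_\sigma)\,\underline{w},$$ where $w=w^*_\sigma$.
   Context: For a function $F=F(n,m)$ of $(n,m)\in\mathbb{Z}^2$: $\widetilde F=F(n+1,m)$, $\widehat F=F(n,m+1)$, $\widehat{\widetilde F}=F(n+1,m+1)$, $\underline F=F(n-1,m)$, $F_\sigma=F(\sigma n,\sigma m)$, and $\widehat F_\sigma=F(\sigma n,\sigma m+\sigma)$. The asterisk denotes (entrywise) complex conjugation, without transposition; $F^*_\sigma$ is the complex conjugate of $F_\sigma$. $|e^{\Gamma^*}|$ is the determinant of $e^{\Gamma^*}$; $|a_0,\dots,a_p;b_0,\dots,b_q|$ is the determinant of the matrix with the listed columns in this order (in $g$ there are $N+2$ columns built from $\Phi$ and $N$ columns built from $T\Phi_\sigma^*$, the latter block being empty if $N=0$). $I$ is the unit matrix, $\coth\Gamma=(e^{2\Gamma}+I)(e^{2\Gamma}-I)^{-1}$, and scalars added to matrices are understood as multiples of $I$. The condition $w=w^*_\sigma$ is part of the equation as it is stated in the source.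
   Formalization: The power m/2 uses the principal square root; for σ=-1 the matrix (4+δε coth Γ)(4-δε coth Γ)^{-1} is assumed to have no negative real eigenvalue, and w=w^*_σ is read as w(n,m)=w(-n-1,-m-1)^*, since otherwise the claim fails. *)

(* Defs.v *)
From HB Require Import structures.
From mathcomp Require Import all_boot all_order all_algebra.
From mathcomp Require Import complex.
From mathcomp Require Import all_classical all_reals all_analysis.

Set Implicit Arguments.
Unset Strict Implicit.
Unset Printing Implicit Defensive.

Import Order.TTheory GRing.Theory Num.Theory.
Import numFieldTopology.Exports numFieldNormedType.Exports.

Local Open Scope classical_set_scope.
Local Open Scope complex_scope.
Local Open Scope ring_scope.

(** Matrix functions *)

Definition expmx (K : numFieldType) (n : nat) (A : 'M[K]_n.+1) : 'M[K]_n.+1 :=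
  lim (series (fun k => (k`!)%:R^-1 *: A ^+ k) @ \oo).

Definition cothmx (K : numFieldType) (n : nat) (A : 'M[K]_n.+1) : 'M[K]_n.+1 :=
  (expmx (A *+ 2) + 1) / (expmx (A *+ 2) - 1).

(* Entrywise conjugation, without transposition. *)
Definition entry_conj (C : numClosedFieldType) (m n : nat) (A : 'M[C]_(m, n)) :
    'M[C]_(m, n) :=
  map_mx Num.conj A.

(* A block-diagonal matrix of Jordan blocks with the ones above the diagonal,
   read off entrywise: a 1 in position (i, i+1) says that i and i+1 lie in the
   same block, so that the two diagonal entries agree, a 0 says that a new
   block starts at i+1. *)
Definition upper_jordan (K : fieldType) (n : nat) (J : 'M[K]_n) : Prop :=
  forall i j : 'I_n,
    [/\ i != j -> j != i.+1 :> nat -> J i j = 0,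
        j = i.+1 :> nat -> J i j = 0 \/ J i j = 1
      & j = i.+1 :> nat -> J i j = 1 -> J i i = J j j].

(* Both conventions (ones above or below the diagonal) are allowed. *)
Definition jordan_form (K : fieldType) (n : nat) (J : 'M[K]_n) : Prop :=
  upper_jordan J \/ upper_jordan J^T.

(* S is the principal square root of A: its eigenvalues have argument in
   ]-pi/2, pi/2]. An invertible A has exactly one such root, and it has none
   if A is singular. Then A^(m/2), for m in Z, is S ^ m. *)
Definition principal_sqrtmx (R : realType) (n : nat) (A S : 'M[R[i]]_n) :
    Prop :=
  S *m S = A /\
  forall s : R[i], eigenvalue S s ->
    0 < complex.Re s \/ (complex.Re s = 0 /\ 0 < complex.Im s).

(** Functions on the lattice Z^2 *)

(* F^*_sigma *)
Definition conj_refl (C : numClosedFieldType) (sigma : int)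
    (F : int -> int -> C) (n m : int) : C :=
  (F (sigma * n) (sigma * m))^*.

Definition cell_ratio (C : fieldType) (f : int -> int -> C) (n m : int) : C :=
  (f (n + 1) m * f n (m + 1)) / (f n m * f (n + 1) (m + 1)).

(* w^*_sigma for a quantity w attached to the elementary cell with corners
   (n, m), (n+1, m), (n, m+1), (n+1, m+1), indexed by its lower left corner.
   The map (x, y) |-> (-x, -y) sends this cell to the one with lower left
   corner (-n-1, -m-1). By cell_ratio_refl below, for w = cell_ratio f this
   is the expression of w with f^*_sigma in place of f. *)
Definition conj_refl_cell (C : numClosedFieldType) (sigma : int)
    (w : int -> int -> C) (n m : int) : C :=
  if sigma == 1 then (w n m)^* else (w (- n - 1) (- m - 1))^*.

Lemma cell_ratio_refl (C : numClosedFieldType) (sigma : int)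
    (f : int -> int -> C) (n m : int) :
  sigma = 1 \/ sigma = -1 ->
  conj_refl_cell sigma (cell_ratio f) n m = cell_ratio (conj_refl sigma f) n m.
Proof.
rewrite /conj_refl_cell /cell_ratio /conj_refl => -[] ->.
  by rewrite eqxx !mul1r rmorphM fmorphV !rmorphM.
have -> : (-1 == 1 :> int) = false by [].
rewrite !mulN1r !opprD !subrK rmorphM fmorphV !rmorphM.
by congr (_ / _); rewrite mulrC.
Qed.

Definition discrete_sine_gordon (R : realType) (eta sigma : int)
    (delta epsilon : R) (u w : int -> int -> R[i]) : Prop :=
  let de := (delta * epsilon)%:C in
  let ee := eta%:~R * epsilon%:C ^+ 2 in
  forall n m : int,
  [/\ 4 * (u n m + u (n + 1) (m + 1) - (u (n + 1) m + u n (m + 1)) * w n m)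
      = de * (u n m + u (n + 1) (m + 1) + (u (n + 1) m + u n (m + 1)) * w n m),
      (1 + ee * u n (m + 1) * conj_refl sigma u n (m + 1)) * w n m
      = (1 + ee * u n m * conj_refl sigma u n m) * w (n - 1) m
    & w n m = conj_refl_cell sigma w n m].

(** The double Casoratian solution *)

(* (4 + delta epsilon coth Gamma) (4 - delta epsilon coth Gamma)^-1 *)
Definition dispersion (R : realType) (n : nat) (delta epsilon : R)
    (Gamma : 'M[R[i]]_n.+1) : 'M[R[i]]_n.+1 :=
  (4%:M + (delta * epsilon)%:C *: cothmx Gamma)
  / (4%:M - (delta * epsilon)%:C *: cothmx Gamma).

Definition phi_vec (R : realType) (k : nat) (Gamma S : 'M[R[i]]_k.+1)
    (C : 'cV[R[i]]_k.+1) (n m : int) : 'cV[R[i]]_k.+1 :=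
  expmx (Gamma *~ n) *m (S ^ m) *m C.

(* The determinant of order 2N+2 with p columns
     e^(-N Gamma) Phi, e^((-N+2) Gamma) Phi, ..., e^((-N+2p-2) Gamma) Phi
   followed by the 2N+2-p columns
     e^(N Gamma) Psi, e^((N-2) Gamma) Psi, ... *)
Definition casoratian (R : realType) (N p : nat) (Gamma : 'M[R[i]]_N.*2.+2)
    (Phi Psi : 'cV[R[i]]_N.*2.+2) : R[i] :=
  \det (\matrix_(i, j)
    (if (j < p)%N
     then (expmx (Gamma *~ (- N%:Z + 2 * j%:Z)) *m Phi) i 0
     else (expmx (Gamma *~ (N%:Z - 2 * (j - p)%:Z)) *m Psi) i 0)).

(* Main.v *)
(** With E = exp Gamma, p = 4 + delta epsilon and q = 4 - delta epsilon, the
    square root S satisfies S^2 (q E - p E^-1) = p E - q E^-1.  A Sylvester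
    argument (A X = - X B forces X = 0 when no eigenvalue of A is the opposite
    of one of B) shows that S is determined by its square and the position of
    its spectrum; hence S commutes with E, T intertwines the conjugate of S
    with S^-sigma, and T Phi^*_sigma = E^-n S^-m T C^*.  The shifts n + 1 and
    m + 1 thus act on the two blocks of columns by E, E^-1 and S, S^-1.

    Let h be the determinant with N columns built from Phi and N + 2 built from
    T Phi^*_sigma.  Up to a common constant, conjugation and reflection turn f
    into f and epsilon g into eta h, so the theorem reduces to two bilinear
    identities, where G = epsilon g:
      f^2 + G h = f(n+1) f(n-1),
      q (G f^~ + G^~ f) = p (G~ f^ + G^ f~).
    The first is a three-term Pluecker relation.  In the second,
    q G f^~ - p G^ f~ and q G^~ f - p G~ f^ are opposite multiples of one and
    the same product, again by three-term Pluecker relations. *)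
Require Import Defs.
From HB Require Import structures.
From mathcomp Require Import all_boot all_order all_algebra.
From mathcomp Require Import complex ring lra zify.
From mathcomp Require Import all_classical all_reals all_analysis.

Set Implicit Arguments.
Unset Strict Implicit.
Unset Printing Implicit Defensive.

Import Order.TTheory GRing.Theory Num.Theory.
Local Open Scope complex_scope.
Local Open Scope ring_scope.

(** * Determinants of sequences of columns *)

Lemma mkseqSl (T : Type) (x : nat -> T) k :
  mkseq x k.+1 = x 0%N :: mkseq (x \o succn) k.
Proof. by rewrite /mkseq /= (iotaDl 1 0) -map_comp. Qed.

Lemma mkseqSr (T : Type) (x : nat -> T) k : mkseq x k.+1 = mkseq x k ++ [:: x k].
Proof. by rewrite mkseqS cats1. Qed.

Lemma sign_double (A : pzRingType) k : (-1) ^+ (k + k) = 1 :> A.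
Proof. by rewrite addnn -mul2n exprM sqrrN !expr1n. Qed.

Section DetSeq.
Variables (K : fieldType) (n : nat).
Implicit Types (s A B : seq 'cV[K]_n) (x y : 'cV[K]_n).

Definition seqmx (s : seq 'cV[K]_n) : 'M[K]_n := \matrix_(i, j) (nth 0 s j) i 0.

(* The value 0 for sequences of the wrong length makes the multilinear and
   alternating rules below hold unconditionally. *)
Definition detseq s : K := if size s == n then \det (seqmx s) else 0.

Lemma detseq_linear A B a x y :
  detseq (A ++ (a *: x + y) :: B) = a * detseq (A ++ x :: B) + detseq (A ++ y :: B).
Proof.
rewrite /detseq !size_cat /=; case: eqP => [sz|_]; last by rewrite mulr0 addr0.
have ltA : (size A < n)%N by lia.
rewrite -!(det_tr (seqmx _)) -[X in _ = _ + X]mul1r.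
apply: (determinant_multilinear (i0 := Ordinal ltA)).
- by apply/rowP=> j; rewrite !mxE !nth_cat /= ltnn subnn !mxE mul1r.
all: apply/matrixP=> i j; rewrite !mxE !nth_cat; case: ltnP => // geA.
all: have /negP neq : size A != lift (Ordinal ltA) i by exact: neq_lift.
all: move: (nat_of_ord (lift _ i)) geA neq => k geA /negP neq.
all: have : (0 < k - size A)%N by rewrite subn_gt0 ltn_neqAle neq.
all: by case: (k - _)%N.
Qed.

Lemma detseqZ A B a x : detseq (A ++ (a *: x) :: B) = a * detseq (A ++ x :: B).
Proof.
have h0 : detseq (A ++ 0 :: B) = 0.
  have := detseq_linear A B 1 0 0; rewrite scaler0 addr0 mul1r => h.
  by apply: (addrI (detseq (A ++ 0 :: B))); rewrite addr0 -h.
by have := detseq_linear A B a x 0; rewrite addr0 h0 addr0.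
Qed.

Lemma detseqD A B x y :
  detseq (A ++ (x + y) :: B) = detseq (A ++ x :: B) + detseq (A ++ y :: B).
Proof. by have := detseq_linear A B 1 x y; rewrite scale1r mul1r. Qed.

Lemma detseqN A B x : detseq (A ++ (- x) :: B) = - detseq (A ++ x :: B).
Proof. by rewrite -scaleN1r detseqZ mulN1r. Qed.

Lemma detseqB A B x y :
  detseq (A ++ (x - y) :: B) = detseq (A ++ x :: B) - detseq (A ++ y :: B).
Proof. by rewrite detseqD detseqN. Qed.

Lemma detseq_nuniq s : ~~ uniq s -> detseq s = 0.
Proof.
move=> /(uniqPn 0)[i [j [ltij ltjs eqij]]]; rewrite /detseq.
case: eqP => [sz|//]; rewrite sz in ltjs.
rewrite -det_tr; apply: (determinant_alternate (i1 := Ordinal (ltn_trans ltij ltjs))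
  (i2 := Ordinal ltjs)) => [|k]; first by rewrite -val_eqE /= ltn_eqF.
by rewrite !mxE /= eqij.
Qed.

Lemma detseq_mem A B x : x \in A ++ B -> detseq (A ++ x :: B) = 0.
Proof.
by move=> xAB; apply: detseq_nuniq; rewrite -cat1s uniq_catCA /= xAB.
Qed.

Lemma detseq_swap A B x y : detseq (A ++ y :: x :: B) = - detseq (A ++ x :: y :: B).
Proof.
have : detseq (A ++ (x + y) :: (x + y) :: B) = 0.
  by apply: detseq_mem; rewrite mem_cat mem_head orbT.
rewrite detseqD -(cat_rcons x A) -(cat_rcons y A) !detseqD !cat_rcons.
rewrite (@detseq_mem A (x :: B) x) ?(@detseq_mem A (y :: B) y);
  rewrite ?mem_cat ?mem_head ?orbT // add0r addr0.
by move=> /eqP; rewrite addr_eq0 => /eqP ->; rewrite opprK.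
Qed.

Lemma detseq_move A B s x :
  detseq (A ++ s ++ x :: B) = (-1) ^+ size s * detseq (A ++ x :: s ++ B).
Proof.
elim: s A => [|y s IH] A /=; first by rewrite mul1r.
by rewrite -cat_rcons IH cat_rcons detseq_swap exprS mulN1r mulNr mulrN.
Qed.

Lemma detseq_block A B s t :
  detseq (A ++ s ++ t ++ B) = (-1) ^+ (size s * size t) * detseq (A ++ t ++ s ++ B).
Proof.
elim: t A => [|y t IH] A; first by rewrite muln0 mul1r.
rewrite cat_cons detseq_move -cat_rcons IH cat_rcons mulrA -exprD.
by rewrite mulnS.
Qed.

Lemma detseq_rev A B s :
  detseq (A ++ rev s ++ B) = (-1) ^+ 'C(size s, 2) * detseq (A ++ s ++ B).
Proof.
elim: s B => [|x s IH] B; first by rewrite mul1r.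
rewrite rev_cons cat_rcons IH detseq_move mulrA -exprD /=.
by rewrite binS bin1 addnC.
Qed.

Lemma detseq_mulmx (P : 'M[K]_n) s :
  detseq [seq P *m x | x <- s] = \det P * detseq s.
Proof.
rewrite /detseq size_map; case: eqP => [sz|_]; last by rewrite mulr0.
rewrite -det_mulmx; congr (\det _); apply/matrixP => i j.
rewrite !mxE (nth_map 0) ?sz // mxE; by apply: eq_bigr => k _; rewrite !mxE.
Qed.

Lemma detseq_scale A B a s :
  detseq (A ++ [seq a *: x | x <- s] ++ B) = a ^+ size s * detseq (A ++ s ++ B).
Proof.
elim: s A => [|x s IH] A /=; first by rewrite mul1r.
by rewrite detseqZ -cat_rcons IH cat_rcons mulrA -exprS.
Qed.

Lemma detseq_mkseqZ A B a (x : nat -> 'cV[K]_n) k :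
  detseq (A ++ mkseq (fun j => a *: x j) k ++ B) = a ^+ k * detseq (A ++ mkseq x k ++ B).
Proof.
rewrite -[k in a ^+ k](size_mkseq x) -detseq_scale /mkseq -map_comp //.
Qed.

(** The columns [s ++ [:: a; b]] form a basis, so [c] expands in it, and a linear functional killing
    [s] sees only the coordinates along [a] and [b]. These are chosen before [L], so that one pair
    serves several functionals. *)
Lemma detseq_decomp s a b c : detseq (s ++ [:: a; b]) != 0 ->
  exists k l : K, forall L : 'cV[K]_n -> K,
    (forall t u v, L (t *: u + v) = t * L u + L v) ->
    {in s, forall u, L u = 0} -> L c = k * L a + l * L b.
Proof.
rewrite /detseq size_cat addn2; case: (_.+2 =P n) => [sz|_]; last by rewrite eqxx.
set M := seqmx _ => Mn0.
have Mu : M \in unitmx by rewrite unitmxE unitfE.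
pose w := invmx M *m c.
pose e t : 'cV[K]_n := nth 0 (s ++ [:: a; b]) t.
have Hw : c = \sum_(j < n) w j 0 *: e j.
  rewrite -[LHS](mulKVmx Mu) -/w; apply/colP=> i; rewrite mxE summxE.
  by apply: eq_bigr => j _; rewrite !mxE mulrC.
have lta : (size s < n)%N by lia.
have ltb : ((size s).+1 < n)%N by lia.
exists (w (Ordinal lta) 0), (w (Ordinal ltb) 0) => L Llin L0.
have L00 : L 0 = 0.
  have := Llin 1 0 0; rewrite scaler0 addr0 mul1r => h.
  by apply: (addrI (L 0)); rewrite addr0 -h.
have -> : L c = \sum_(j < n) w j 0 * L (e j).
  rewrite Hw; elim/big_ind2: _ => // [u1 u2 v1 v2 <- <-|j _].
    by have := Llin 1 u2 v2; rewrite scale1r mul1r.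
  by have := Llin (w j 0) (e j) 0; rewrite addr0 L00 addr0.
rewrite (bigD1 (Ordinal lta)) //= (bigD1 (Ordinal ltb)) /=; last first.
  by rewrite -val_eqE /=; lia.
have -> : e (size s) = a by rewrite /e nth_cat ltnn subnn.
have -> : e (size s).+1 = b by rewrite /e nth_cat ltnNge leqnSn subSnn.
rewrite big1 ?addr0 // => j; rewrite -!val_eqE /= => /andP[ja jb].
have ltj : (j < size s)%N by have := ltn_ord j; lia.
by rewrite /e nth_cat ltj L0 ?mulr0 // mem_nth.
Qed.

(** For fixed [s] the determinant is an alternating bilinear form on the quotient by the span of
    [s], which is two-dimensional unless the form vanishes. There the form is a multiple of the 2 by
    2 determinant, for which the relation is a polynomial identity. *)
Lemma plucker_rel s a b c d :
  detseq (s ++ [:: a; b]) * detseq (s ++ [:: c; d])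
  - detseq (s ++ [:: a; c]) * detseq (s ++ [:: b; d])
  + detseq (s ++ [:: a; d]) * detseq (s ++ [:: b; c]) = 0.
Proof.
pose f x y := detseq (s ++ [:: x; y]).
have fC x y : f x y = - f y x by exact: detseq_swap.
have fl y t u v : f (t *: u + v) y = t * f u y + f v y by exact: detseq_linear.
have fxx x : f x x = 0 by apply: detseq_mem; rewrite mem_cat mem_head orbT.
have fs y : {in s, forall u, f u y = 0}.
  by move=> u us; apply: detseq_mem; rewrite mem_cat us.
have main x y z t : f x y != 0 -> f x y * f z t - f x z * f y t + f x t * f y z = 0.
  move=> /(detseq_decomp z)[k [l h]].
  rewrite [f z t](h (f^~ t)) // [f x z]fC [f y z]fC.
  rewrite [f z x](h (f^~ x)) // [f z y](h (f^~ y)) //.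
  rewrite !fxx [f y x]fC; ring.
rewrite -/(f a b) -/(f c d) -/(f a c) -/(f b d) -/(f a d) -/(f b c).
(* [main] needs a nonzero first factor. Up to sign the relation is symmetric in [b], [c], [d], so
   any nonzero value among [f a b], [f a c], [f a d] will do; if all three vanish, so does every
   term. *)
have [ab|] := eqVneq (f a b) 0; last exact: main.
have [ac|/(main a c b d) h] := eqVneq (f a c) 0; last first.
  by rewrite -oppr0 -h [f c b]fC; ring.
have [ad|/(main a d b c) h] := eqVneq (f a d) 0; last first.
  by rewrite -[RHS]h [f d c]fC [f d b]fC; ring.
by rewrite ab ac ad !mul0r subr0 addr0.
Qed.

(** Column operations from right to left: the column [x j] is still present when a multiple of it is
    added to [m *: x j.+1]. *)
Lemma detseq_telescope A B (x : nat -> 'cV[K]_n) l m k :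
  m ^+ k * detseq (A ++ mkseq x k.+1 ++ B) =
  detseq (A ++ x 0%N :: mkseq (fun j => l *: x j + m *: x j.+1) k ++ B).
Proof.
elim: k B => [|k IH] B; first by rewrite mul1r.
rewrite (mkseqS x) (mkseqS (fun j => _ + _)) !cat_rcons exprS -mulrA.
rewrite -IH mulrCA; congr (_ * _).
rewrite [in RHS]catA detseqD !detseqZ [X in _ = l * X + _]detseq_mem.
  by rewrite mulr0 add0r -!catA.
by rewrite mkseqS -cats1 !mem_cat mem_head !orbT.
Qed.

(** The mirror image: working from left to right keeps the last column instead of the first. *)
Lemma detseq_telescope' A B (x : nat -> 'cV[K]_n) l m k :
  l ^+ k * detseq (A ++ mkseq x k.+1 ++ B) =
  detseq (A ++ mkseq (fun j => l *: x j + m *: x j.+1) k ++ x k :: B).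
Proof.
elim: k A x => [|k IH] A x; first by rewrite mul1r.
rewrite exprSr -mulrA.
rewrite (mkseqSl (fun j => _ *: _ + _)) [in RHS]cat_cons -[in RHS]cat_rcons.
rewrite -[RHS](IH _ (x \o succn)).
congr (_ * _); rewrite cat_rcons detseqD !detseqZ [X in _ = _ + m * X]detseq_mem.
  by rewrite mulr0 addr0 mkseqSl.
by rewrite mkseqSl !mem_cat mem_head !orbT.
Qed.

End DetSeq.

(** * Three-term bilinear identities for runs of columns *)

Section Bilinear.
Variables (K : fieldType) (n : nat).
Implicit Types (A : seq 'cV[K]_n) (a b e : nat -> 'cV[K]_n).

(* Read e j as t^j: then b, c and d are the multiples of t^j by p - q t, q - p t
   and their product, and this is the Pluecker relation attached to the three
   points p/q, q/p and infinity of the t-line. *)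
Lemma detseq_core A v e (p q : K) (N : nat) :
  let b j := p *: e j + (- q) *: e j.+1 in
  let c j := q *: e j + (- p) *: e j.+1 in
  let d j := q *: b j + (- p) *: b j.+1 in
  q * detseq (A ++ v :: mkseq b N) * detseq (A ++ mkseq c N.+1)
  - p * detseq (A ++ v :: mkseq c N) * detseq (A ++ mkseq b N.+1)
  = (q ^+ 2 - p ^+ 2) * detseq (A ++ v :: mkseq d N) * detseq (A ++ mkseq e N.+1).
Proof.
move=> b c d; pose D := @detseq K n.
have dE j : d j = p *: c j + (- q) *: c j.+1.
  by apply/colP=> i; rewrite !mxE; ring.
case: N => [|M].
  rewrite /mkseq /=.
  have key : q * D (A ++ [:: c 0%N]) - p * D (A ++ [:: b 0%N]) =
      (q ^+ 2 - p ^+ 2) * D (A ++ [:: e 0%N]).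
    rewrite /D -!detseqZ -detseqB; congr (detseq (_ ++ [:: _])).
    by apply/colP=> i; rewrite !mxE; ring.
  by rewrite [RHS]mulrAC -/D -key; ring.
(* The main argument cancels powers of [p]. For [p = 0] the columns [c] and [d] are just [q] times
   [e] and [b]. *)
have [p0|pn0] := eqVneq p 0.
  have cE j : c j = q *: e j by rewrite /c p0 oppr0 scale0r addr0.
  have dqE j : d j = q *: b j by rewrite /d p0 oppr0 scale0r addr0.
  rewrite -(cat_rcons v) -(cat_rcons v _ (mkseq d _)).
  rewrite -[mkseq c M.+2]cats0 (eq_mkseq cE) -[mkseq d _]cats0 (eq_mkseq dqE).
  by rewrite !detseq_mkseqZ !cats0 cat_rcons p0 !exprS; ring.
(* With [N = M.+1], telescoping makes the columns of [s] common to all six determinants: up to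
   scalar factors each becomes an [f] of two among [v], [b 0], [c M] and [d M]. *)
pose s := A ++ mkseq d M.
pose f x y := D (s ++ [:: x; y]).
have fE x y : D (A ++ x :: mkseq d M ++ [:: y]) = (-1) ^+ M * f x y.
  by rewrite /f /s -catA /D detseq_move size_mkseq mulrA -exprD sign_double mul1r.
have fac1 : (- p) ^+ M * D (A ++ v :: mkseq b M.+1) = f v (b 0%N).
  rewrite -cat_rcons -[mkseq b _]cats0 /D (detseq_telescope _ _ _ q) cats0 cat_rcons.
  rewrite -/d /f /s -catA.
  have := detseq_block A [::] (mkseq d M) [:: v; b 0%N].
  by rewrite /= size_mkseq muln2 -addnn sign_double mul1r cats0 => <-.
have fac2 : p ^+ M * D (A ++ v :: mkseq c M.+1) = (-1) ^+ M * f v (c M).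
  rewrite -fE -(cat_rcons v) -[mkseq c _]cats0 /D (detseq_telescope' _ _ _ _ (- q)).
  by rewrite -(eq_mkseq dE) cat_rcons.
have fac3 : q * p ^+ M.+1 * D (A ++ mkseq c M.+2) = - p * f (c M) (d M).
  rewrite -mulrA -[mkseq c _]cats0 /D (detseq_telescope' _ _ _ _ (- q)).
  rewrite -(eq_mkseq dE) mkseqSr -catA /= catA -cat_rcons -detseqZ.
  have -> : q *: c M.+1 = p *: c M - d M.
    by apply/colP=> i; rewrite dE !mxE; ring.
  rewrite detseqB detseqZ [X in _ - X]detseq_mem ?cats0 ?mem_rcons ?mem_head //.
  by rewrite cat_rcons detseq_swap /f /s /D; ring.
have fac4 : (- p) ^+ M.+1 * D (A ++ mkseq b M.+2) = (-1) ^+ M * f (b 0%N) (d M).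
  rewrite -fE -[mkseq b _]cats0 /D (detseq_telescope _ _ _ q) -/d cats0.
  by rewrite mkseqSr.
have fac5 : D (A ++ v :: mkseq d M.+1) = (-1) ^+ M * f v (d M).
  by rewrite -fE mkseqSr.
(* A first telescoping turns [e 0, ..., e M] into [b 0, ..., b M] and keeps [e M.+1]. Modulo [b M],
   the multiple of [e M.+1] by [q ^+ 2 - p ^+ 2] is [p *: c M]. A second telescoping keeps [b 0] and
   produces the columns [d]. *)
have fac6 : (q ^+ 2 - p ^+ 2) * p ^+ M.+1 * (- p) ^+ M * D (A ++ mkseq e M.+2) =
    p * ((-1) ^+ M * f (b 0%N) (c M)).
  rewrite -fE; transitivity ((- p) ^+ M *
    ((q ^+ 2 - p ^+ 2) * (p ^+ M.+1 * D (A ++ mkseq e M.+2)))); first by ring.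
  rewrite -[mkseq e _]cats0 /D (detseq_telescope' _ _ _ _ (- q)) -/b.
  rewrite catA -detseqZ.
  have -> : (q ^+ 2 - p ^+ 2) *: e M.+1 = p *: c M - q *: b M.
    by apply/colP=> i; rewrite !mxE; ring.
  rewrite detseqB !detseqZ [X in _ - _ * X]detseq_mem; last first.
    by rewrite mkseqSr cats0 !mem_cat mem_head !orbT.
  rewrite mulr0 subr0 mulrCA -catA; congr (_ * _).
  by rewrite (detseq_telescope _ _ _ q).
have nz : p ^+ M.+1 * (- p) ^+ M != 0 by rewrite mulf_neq0 ?expf_neq0 ?oppr_eq0.
apply: (mulfI nz); rewrite -/D.
have -> : p ^+ M.+1 * (- p) ^+ M *
    (q * D (A ++ v :: mkseq b M.+1) * D (A ++ mkseq c M.+2)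
     - p * D (A ++ v :: mkseq c M.+1) * D (A ++ mkseq b M.+2)) =
  ((- p) ^+ M * D (A ++ v :: mkseq b M.+1)) * (q * p ^+ M.+1 * D (A ++ mkseq c M.+2))
  + p * (p ^+ M * D (A ++ v :: mkseq c M.+1)) * ((- p) ^+ M.+1 * D (A ++ mkseq b M.+2)).
  by rewrite !exprS; ring.
have -> : p ^+ M.+1 * (- p) ^+ M *
    ((q ^+ 2 - p ^+ 2) * D (A ++ v :: mkseq d M.+1) * D (A ++ mkseq e M.+2)) =
  ((q ^+ 2 - p ^+ 2) * p ^+ M.+1 * (- p) ^+ M * D (A ++ mkseq e M.+2))
  * D (A ++ v :: mkseq d M.+1) by ring.
rewrite fac1 fac2 fac3 fac4 fac5 fac6.
have sq : (-1) ^+ M * (-1) ^+ M = 1 :> K by rewrite -exprD sign_double.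
have := plucker_rel s v (b 0%N) (c M) (d M).
rewrite -/D -!/(f _ _).
move: (f v (b 0%N)) (f (c M) (d M)) (f v (c M)) (f (b 0%N) (d M)).
move=> y1 y2 y3 y4; move: (f v (d M)) (f (b 0%N) (c M)) => y5 y6 pl.
move: sq; set g := (-1) ^+ M => sq.
have -> : y1 * (- p * y2) + p * (g * y3) * (g * y4) =
    p * (g * g * (y3 * y4) - y1 * y2) by ring.
have -> : p * (g * y6) * (g * y5) = p * (g * g * (y5 * y6)) by ring.
rewrite sq !mul1r; congr (_ * _).
by apply/eqP; rewrite eq_sym -subr_eq0; apply/eqP; rewrite -[RHS]pl; ring.
Qed.

(** All six determinants contain [a 1, ..., a N] and [b 1, ..., b N]; they differ in the choice of
    two further columns among [a 0], [a N.+1], [b 0], [b N.+1]. Up to reordering, this is one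
    Pluecker relation. *)
Lemma detseq_toda a b (N : nat) :
  let a1 := a \o succn in let b1 := b \o succn in
  detseq (mkseq a N.+1 ++ mkseq b1 N.+1) * detseq (mkseq a1 N.+1 ++ mkseq b N.+1)
  + detseq (mkseq a N.+2 ++ mkseq b1 N) * detseq (mkseq a1 N ++ mkseq b N.+2)
  = detseq (mkseq a1 N.+1 ++ mkseq b1 N.+1) * detseq (mkseq a N.+1 ++ mkseq b N.+1).
Proof.
move=> a1 b1; pose s := mkseq a1 N ++ mkseq b1 N.
pose f x y := @detseq K n (s ++ [:: x; y]).
set x := a 0%N; set y := a N.+1; set z := b 0%N; set t := b N.+1.
have sS : size s = (N + N)%N by rewrite size_cat !size_mkseq.
have move0 u v : detseq (u :: s ++ [:: v]) = f u v.
  by rewrite /f; have /= -> := detseq_move [::] [:: v] s u; rewrite sS sign_double mul1r.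
have moveb u v : detseq (mkseq a1 N ++ u :: mkseq b1 N ++ [:: v]) = (-1) ^+ N * f u v.
  by rewrite /f /s -catA detseq_move size_mkseq mulrA -exprD sign_double mul1r.
have -> : detseq (mkseq a N.+1 ++ mkseq b1 N.+1) = f x t.
  by rewrite -move0 mkseqSl mkseqSr /s /= -catA.
have -> : detseq (mkseq a1 N.+1 ++ mkseq b N.+1) = f y z.
  rewrite mkseqSr mkseqSl -catA /= -/a1 -/b1 /f /s.
  have := detseq_block (mkseq a1 N) [::] (mkseq b1 N) [:: y; z].
  rewrite /= size_mkseq muln2 -addnn sign_double mul1r cats0 => <-.
  by rewrite -!catA.
have -> : detseq (mkseq a N.+2 ++ mkseq b1 N) = (-1) ^+ N * f x y.
  rewrite mkseqSl mkseqSr -/a1 /= -/x -move0 /s.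
  have := detseq_move (x :: mkseq a1 N) [::] (mkseq b1 N) (a1 N).
  rewrite size_mkseq cats0 /= -!catA => -> /=.
  by rewrite mulrA -exprD sign_double mul1r.
have -> : detseq (mkseq a1 N ++ mkseq b N.+2) = (-1) ^+ N * f z t.
  by rewrite -moveb mkseqSl mkseqSr.
have -> : detseq (mkseq a1 N.+1 ++ mkseq b1 N.+1) = (-1) ^+ N * f y t.
  by rewrite -moveb !mkseqSr -catA.
have -> : detseq (mkseq a N.+1 ++ mkseq b N.+1) = (-1) ^+ N * f x z.
  rewrite !mkseqSl -/a1 -/b1 /= -/x -move0 /s.
  have := detseq_move (x :: mkseq a1 N) [::] (mkseq b1 N) z.
  rewrite size_mkseq cats0 /= -!catA => -> /=.
  by rewrite mulrA -exprD sign_double mul1r.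
have sq : (-1) ^+ N * (-1) ^+ N = 1 :> K by rewrite -exprD sign_double.
have := plucker_rel s x y z t; rewrite -!/(f _ _).
rewrite ![(_ * f _ _) * (_ * f _ _)]mulrACA sq !mul1r => pl.
by apply/eqP; rewrite -subr_eq0; apply/eqP; rewrite -[RHS]pl; ring.
Qed.

End Bilinear.

(** * Double Casoratians and their bilinear identities *)

Section Casoratian.
Variables (K : fieldType) (N : nat).
Notation n := N.*2.+2.
Variable E : 'M[K]_n.
Hypothesis Eu : E \is a GRing.unit.
Implicit Types (x y : 'cV[K]_n).

Definition upcol x (j : nat) := E ^ (- N%:Z + 2 * j%:Z) *m x.
Definition downcol x (j : nat) := E ^ (N%:Z - 2 * j%:Z) *m x.

(** [casoratian] with an arbitrary unit [E] in place of the exponential ([casoratianE]), which makes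
    the bilinear identities purely algebraic. *)
Definition cas (k : nat) x y : K :=
  detseq (mkseq (upcol x) k ++ mkseq (downcol y) (n - k)).

Lemma expzDmul a b x : E ^ a *m (E ^ b *m x) = E ^ (a + b) *m x.
Proof. by rewrite exprzDr // mulmxA. Qed.

Lemma upcolZ (z : int) x j i : z = 2 * i%:Z -> upcol (E ^ z *m x) j = upcol x (j + i).
Proof. by move=> ->; rewrite /upcol expzDmul; congr (E ^ _ *m _); lia. Qed.

(** Such an [A] passes through the powers of [E] and comes out as a left factor of the whole matrix.
    Acting by one [A] on both blocks is thus a gauge freedom, used below to normalise shifted
    arguments. *)
Lemma cas_comm (A : 'M[K]_n) k x y : GRing.comm A E ->
  cas k (A *m x) (A *m y) = \det A * cas k x y.
Proof.
move=> cAE; have cA z : A *m E ^ z = E ^ z *m A by apply: commrXz.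
rewrite /cas -detseq_mulmx map_cat /mkseq -!map_comp; congr (detseq (_ ++ _));
  by apply: eq_map => j; rewrite /= /upcol /downcol !mulmxA cA.
Qed.

Lemma cas_toda x y :
  cas N.+1 x y ^+ 2 + cas N.+2 x y * cas N x y =
  cas N.+1 (E *m x) (E^-1 *m y) * cas N.+1 (E^-1 *m x) (E *m y).
Proof.
have d1 : (n - N.+1)%N = N.+1 by lia.
have d2 : (n - N.+2)%N = N by lia.
have d0 : (n - N)%N = N.+2 by lia.
have Ed : \det E != 0 by rewrite -unitfE -unitmxE.
have E2 z : E ^ 2 *m z = E *m (E *m z) by rewrite mulmxA.
have cEE k u v : cas k (E ^ 2 *m u) (E ^ 2 *m v) = \det E ^+ 2 * cas k u v.
  by rewrite !E2 !cas_comm // mulrA.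
have EK z : E *m (E^-1 *m z) = z by rewrite mulKVmx.
(* Neighbouring columns differ by [E ^ 2], so only even powers of [E] shift the index. Applying [E]
   to both blocks turns the pair [(E x, E^-1 y)] into [(E^2 x, y)], and [(E^-1 x, E y)] into
   [(x, E^2 y)]. *)
have shift : \det E ^+ 2 *
      (cas N.+1 (E *m x) (E^-1 *m y) * cas N.+1 (E^-1 *m x) (E *m y))
    = cas N.+1 (E ^ 2 *m x) y * cas N.+1 x (E ^ 2 *m y).
  by rewrite expr2 mulrACA -!cas_comm // !EK !E2.
apply: (mulfI (expf_neq0 2 Ed)); rewrite shift mulrDr [cas N.+1 x y ^+ 2]expr2.
rewrite mulrCA [in X in _ + X]mulrCA -!cEE.
have upS z : mkseq (upcol (E ^ 2 *m z)) =1 mkseq (upcol z \o succn).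
  by move=> k; apply: eq_mkseq => j; rewrite (@upcolZ _ _ _ 1) // addn1.
have downS : downcol y =1 downcol (E ^ 2 *m y) \o succn.
  move=> j; rewrite /downcol /= expzDmul; congr (E ^ _ *m _); lia.
rewrite /cas d0 d1 d2 !upS !(eq_mkseq downS).
exact: (detseq_toda (upcol x) (downcol (E ^ 2 *m y)) N).
Qed.

Variables p q : K.
Let P := p *: E - q *: E^-1.
Let Q := q *: E - p *: E^-1.

Lemma colP z x : E ^ z *m (P *m x) = p *: (E ^ (z + 1) *m x) + (- q) *: (E ^ (z - 1) *m x).
Proof.
rewrite /P mulmxBl mulmxBr -!scalemxAl -!scalemxAr scaleNr.
by rewrite -[E *m x]/(E ^ 1 *m x) -[E^-1 *m x]/(E ^ (-1) *m x) !expzDmul.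
Qed.

Lemma colQ z x : E ^ z *m (Q *m x) = q *: (E ^ (z + 1) *m x) + (- p) *: (E ^ (z - 1) *m x).
Proof.
rewrite /Q mulmxBl mulmxBr -!scalemxAl -!scalemxAr scaleNr.
by rewrite -[E *m x]/(E ^ 1 *m x) -[E^-1 *m x]/(E ^ (-1) *m x) !expzDmul.
Qed.

(* The identity for q G f^~ - p G^ f~, in the gauge where the hat shift leaves
   the first block alone and replaces P y by Q y in the second; cas_half' is the
   one for q G^~ f - p G~ f^. *)
Lemma cas_half x y :
  q * cas N.+2 x (P *m y) * cas N.+1 (E ^ 2 *m x) (Q *m y)
  - p * cas N.+2 x (Q *m y) * cas N.+1 (E ^ 2 *m x) (P *m y)
  = (q ^+ 2 - p ^+ 2) * cas N.+2 x (E ^ (-1) *m (Q *m (P *m y)))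
    * cas N.+1 (E ^ 2 *m x) (E ^ 1 *m y).
Proof.
have d1 : (n - N.+1)%N = N.+1 by lia.
have d2 : (n - N.+2)%N = N by lia.
have upS z : mkseq (upcol (E ^ 2 *m z)) =1 mkseq (upcol z \o succn).
  by move=> k; apply: eq_mkseq => j; rewrite (@upcolZ _ _ _ 1) // addn1.
pose A := mkseq (upcol x \o succn) N.+1.
have front s : detseq (mkseq (upcol x) N.+2 ++ s) =
    (-1) ^+ N.+1 * detseq (A ++ upcol x 0 :: s).
  have := detseq_move [::] s A (upcol x 0).
  rewrite !cat0s (_ : size A = N.+1) ?size_mkseq // => ->.
  by rewrite mulrA -exprD sign_double mul1r mkseqSl.
rewrite /cas d1 d2 !upS !front -/A.
(* Multiplication by [t] is here multiplication by [E ^ (-2)]; the half step [E ^ 1] in [e] makes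
   [b] and [c] the columns of [P *m y] and [Q *m y]. *)
have := detseq_core A (upcol x 0) (downcol (E ^ 1 *m y)) p q N.
move=> /[let] b /[let] c /[let] d.
have bE : b =1 downcol (P *m y).
  move=> j; rewrite /b /downcol colP !expzDmul.
  congr (_ *: (E ^ _ *m _) + _ *: (E ^ _ *m _)); lia.
have cE : c =1 downcol (Q *m y).
  move=> j; rewrite /c /downcol colQ !expzDmul.
  congr (_ *: (E ^ _ *m _) + _ *: (E ^ _ *m _)); lia.
have dE : d =1 downcol (E ^ (-1) *m (Q *m (P *m y))).
  move=> j; rewrite /d !bE /downcol expzDmul (colQ _ (P *m y)).
  congr (_ *: (E ^ _ *m _) + _ *: (E ^ _ *m _)); lia.
rewrite !(eq_mkseq bE) !(eq_mkseq cE) !(eq_mkseq dE) => core.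
have pull t g u1 u2 : t * (g * u1) * u2 = g * (t * u1 * u2) :> K by ring.
by rewrite !pull -mulrBr core.
Qed.

Lemma cas_half' x y :
  q * cas N.+2 x (E ^ (-2) *m (Q *m y)) * cas N.+1 x (P *m y)
  - p * cas N.+2 x (E ^ (-2) *m (P *m y)) * cas N.+1 x (Q *m y)
  = - ((q ^+ 2 - p ^+ 2) * cas N.+2 x (E ^ (-1) *m (Q *m (P *m y)))
    * cas N.+1 x (E ^ (-1) *m y)).
Proof.
have d1 : (n - N.+1)%N = N.+1 by lia.
have d2 : (n - N.+2)%N = N by lia.
pose A := mkseq (upcol x) N.+1; pose v := upcol x N.+1.
have front s : mkseq (upcol x) N.+2 ++ s = A ++ v :: s by rewrite mkseqS cat_rcons.
(* A reversed run of [downcol] is a run of [upcol]. After the reversal [t] acts as [E ^ 2] instead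
   of [E ^ (-2)], which exchanges the roles of [P] and [Q]. *)
have revE k u u' : (forall j, (j < k)%N -> downcol u' j = upcol u (k - j.+1)) ->
    forall B, detseq (B ++ mkseq (downcol u') k) =
      (-1) ^+ 'C(k, 2) * detseq (B ++ mkseq (upcol u) k).
  move=> h B; have := detseq_rev B [::] (mkseq (upcol u) k).
  rewrite !cats0 size_mkseq => <-; congr (detseq (_ ++ _)).
  apply: (@eq_from_nth _ 0); rewrite ?size_rev ?size_mkseq // => j ltj.
  by rewrite nth_rev ?size_mkseq // !nth_mkseq ?h //; lia.
have r1 u := revE N u (E ^ (-2) *m u).
have r2 u := revE N.+1 u u.
have r3 u := revE N (E ^ 1 *m u) (E ^ (-1) *m u).
have PQ : P *m (Q *m y) = Q *m (P *m y).
  rewrite !mulmxA; congr (_ *m _); rewrite /P /Q.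
  have EE : E *m E^-1 = E^-1 *m E by rewrite [LHS]divrr // [RHS]mulVr.
  rewrite !mulmxBl !mulmxBr -!scalemxAl -!scalemxAr EE !scalerA.
  by rewrite [q * p]mulrC [p * p]mulrC; apply/matrixP=> i j; rewrite !mxE; ring.
rewrite /cas d1 d2 !front -/A -!(cat_rcons v).
rewrite !r1 ?r2 ?r3; last first.
all: try by move=> j lj; rewrite /downcol /upcol ?expzDmul; congr (E ^ _ *m _); lia.
have := detseq_core A v (upcol (E ^ (-1) *m y)) p q N.
move=> /[let] b /[let] c /[let] d.
have bE : b =1 fun j => (-1) *: upcol (Q *m y) j.
  move=> j; rewrite /b /upcol colQ !expzDmul scaleN1r opprD -!scaleNr opprK addrC.
  congr (_ *: (E ^ _ *m _) + _ *: (E ^ _ *m _)); lia.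
have cE : c =1 fun j => (-1) *: upcol (P *m y) j.
  move=> j; rewrite /c /upcol colP !expzDmul scaleN1r opprD -!scaleNr opprK addrC.
  congr (_ *: (E ^ _ *m _) + _ *: (E ^ _ *m _)); lia.
have dE : d =1 upcol (E ^ 1 *m (Q *m (P *m y))).
  move=> j; rewrite /d !bE -PQ /upcol expzDmul (colP _ (Q *m y)).
  rewrite !scaleN1r !scalerN -!scaleNr opprK addrC.
  congr (_ *: (E ^ _ *m _) + _ *: (E ^ _ *m _)); lia.
rewrite !(eq_mkseq bE) !(eq_mkseq cE) !(eq_mkseq dE).
have signE B z k : detseq (B ++ mkseq (fun j => (-1) *: upcol z j) k) =
    (-1) ^+ k * detseq (B ++ mkseq (upcol z) k).
  by rewrite -[mkseq _ k]cats0 detseq_mkseqZ cats0.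
(* Each product on the left of [detseq_core] contains [N] plus [N.+1] negated columns; this odd
   number gives the sign opposite to that in [cas_half]. *)
rewrite -!(cat_rcons v) !signE exprS.
have gg : (-1) ^+ N * (-1) ^+ N = 1 :> K by rewrite -exprD sign_double.
move: ((-1) ^+ N) gg ((-1) ^+ 'C(N, 2)) ((-1) ^+ 'C(N.+1, 2)) => g gg s1 s2.
set X1 := detseq (rcons A v ++ mkseq (upcol (Q *m y)) _).
set X2 := detseq (A ++ mkseq (upcol (P *m y)) _).
set X3 := detseq (rcons A v ++ mkseq (upcol (P *m y)) _).
set X4 := detseq (A ++ mkseq (upcol (Q *m y)) _).
set X5 := detseq (rcons A v ++ _).
set X6 := detseq (A ++ _) => core.
have -> : (q ^+ 2 - p ^+ 2) * (s1 * X5) * (s2 * X6) =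
  s1 * s2 * ((q ^+ 2 - p ^+ 2) * X5 * X6) by ring.
rewrite -core; transitivity (g * g * (s1 * s2 * (q * X1 * X2 - p * X3 * X4))).
  by rewrite gg; ring.
ring.
Qed.

(** [cas_half] and [cas_half'] are taken at [z = P^-1 y], so that [P z = y] and [Q z = S^-2 y];
    their right-hand sides cancel once the gauge factors [\det E] and [\det S] are restored. *)
Lemma cas_bilinear (S : 'M[K]_n) x y : P \is a GRing.unit -> S \is a GRing.unit ->
  GRing.comm S E -> S *m (S *m Q) = P ->
  q * (cas N.+2 x y * cas N.+1 (E *m (S *m x)) (E^-1 *m (S^-1 *m y))
       + cas N.+2 (E *m (S *m x)) (E^-1 *m (S^-1 *m y)) * cas N.+1 x y)
  = p * (cas N.+2 (E *m x) (E^-1 *m y) * cas N.+1 (S *m x) (S^-1 *m y)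
       + cas N.+2 (S *m x) (S^-1 *m y) * cas N.+1 (E *m x) (E^-1 *m y)).
Proof.
move=> Pu Su cSE SQ.
have Ed : \det E != 0 by rewrite -unitfE -unitmxE.
pose z := P^-1 *m y.
have Pz : P *m z = y by rewrite mulKVmx.
have Qz : Q *m z = S^-1 *m (S^-1 *m y) by rewrite -Pz -SQ -!mulmxA !mulKmx.
have cE2 k u v : cas k (E ^ 2 *m u) (E ^ 2 *m v) = \det E ^+ 2 * cas k u v.
  have cEE : GRing.comm E E by [].
  have E2 t : E ^ 2 *m t = E *m (E *m t) by rewrite mulmxA.
  by rewrite !E2 !cas_comm // mulrA.
have Em2 (u : 'cV[K]_n) : E ^ 2 *m (E ^ (-2) *m u) = u.
  by rewrite expzDmul addrN expr0z mul1mx.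
have Em2' (u : 'cV[K]_n) : E ^ (-2) *m u = E^-1 *m (E^-1 *m u).
  by rewrite -[E^-1 *m (E^-1 *m u)]/(E ^ (-1) *m (E ^ (-1) *m u)) expzDmul.
have casE k u v : cas k (E *m u) (E^-1 *m v) = \det E * cas k u (E ^ (-2) *m v).
  by rewrite Em2' -cas_comm ?mulKVmx.
have casS k u v : cas k (S *m u) (S^-1 *m v) = \det S * cas k u (S^-1 *m (S^-1 *m v)).
  by rewrite -cas_comm ?mulKVmx.
have cSV : S^-1 *m E^-1 = E^-1 *m S^-1.
  by apply: commrV; apply: commr_sym; apply: commrV; apply: commr_sym.
have h1 := cas_half x z; have h2 := cas_half' x z.
rewrite !Pz !Qz in h1 h2.
have dF (u : 'cV[K]_n) :
    cas N.+1 (E ^ 2 *m x) u = \det E ^+ 2 * cas N.+1 x (E ^ (-2) *m u).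
  by rewrite -cE2 Em2.
have E1 : E ^ 1 *m z = E ^ 2 *m (E ^ (-1) *m z) by rewrite expzDmul.
rewrite E1 cE2 !dF in h1.
have swap (u : 'cV[K]_n) : E ^ (-2) *m (S^-1 *m u) = S^-1 *m (E ^ (-2) *m u).
  rewrite !Em2' !mulmxA; congr (_ *m _).
  by rewrite -mulmxA -cSV mulmxA -cSV.
rewrite !casE !swap !casS -!swap.
set F0 := cas N.+1 x y in h1 h2 *; set G0 := cas N.+2 x y in h1 h2 *.
apply: (mulfI Ed); apply/eqP; rewrite -subr_eq0; apply/eqP.
rewrite -[RHS](mulr0 (\det S)); transitivity (\det S *
  ((q ^+ 2 - p ^+ 2) * cas N.+2 x (E ^ (-1) *m (Q *m y))
     * (\det E ^+ 2 * cas N.+1 x (E ^ (-1) *m z))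
   + \det E ^+ 2 * - ((q ^+ 2 - p ^+ 2) * cas N.+2 x (E ^ (-1) *m (Q *m y))
     * cas N.+1 x (E ^ (-1) *m z)))).
  by rewrite -h1 -h2; ring.
by congr (_ * _); ring.
Qed.

End Casoratian.

(** * Conjugation of double Casoratians *)

Lemma intertwineXz (R : unitRingType) (t a b : R) (z : int) :
  a \is a GRing.unit -> b \is a GRing.unit -> t * a = b * t -> t * a ^ z = b ^ z * t.
Proof.
move=> au bu tab.
have nat_case k : t * a ^+ k = b ^+ k * t.
  elim: k => [|k IH]; first by rewrite !expr0 mulr1 mul1r.
  by rewrite exprS mulrA tab -mulrA IH mulrA -exprS.
case: z => k; first exact: nat_case.
rewrite NegzE -!exprnN.
apply: (mulrI (unitrX k.+1 bu)); rewrite mulrA -nat_case -mulrA.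
by rewrite mulrV ?unitrX // mulr1 mulrA mulrV ?unitrX // mul1r.
Qed.

Lemma conj_expz (C : numClosedFieldType) (n : nat) (E T : 'M[C]_n.+1) (sigma : int) :
  E \is a GRing.unit -> T *m entry_conj E = E ^ (- sigma) *m T ->
  forall z, T *m entry_conj (E ^ z) = E ^ (- sigma * z) *m T.
Proof.
move=> Eu TE z; have Eu' : entry_conj E \is a GRing.unit by apply: rmorph_unit.
rewrite /entry_conj (rmorphXz (map_mx (@Num.conj C) : 'M[C]_n.+1 -> 'M[C]_n.+1)) //.
by rewrite -exprz_exp; apply: intertwineXz; rewrite ?unitrXz.
Qed.

Section Conjugation.
Variables (C : numClosedFieldType) (N : nat).
Notation n := N.*2.+2.

Lemma detseq_conj m (s : seq 'cV[C]_m) : (detseq s)^* = detseq [seq entry_conj x | x <- s].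
Proof.
rewrite /detseq size_map; case: eqP => [sz|_]; last by rewrite conjC0.
rewrite -det_map_mx; congr (\det _); apply/matrixP => i j.
by rewrite !mxE (nth_map 0) ?sz // mxE.
Qed.

Variables (E T : 'M[C]_n) (tau : C) (sigma : int).
Hypothesis Eu : E \is a GRing.unit.
Hypothesis TE : T *m entry_conj E = E ^ (- sigma) *m T.
Implicit Types (x y u v : 'cV[C]_n).

Lemma cas_conj k x y : \det T * (cas E k x y)^* =
  detseq (mkseq (fun j => E ^ (- sigma * (- N%:Z + 2 * j%:Z)) *m (T *m entry_conj x)) k ++
          mkseq (fun j => E ^ (- sigma * (N%:Z - 2 * j%:Z)) *m (T *m entry_conj y)) (n - k)).
Proof.
rewrite /cas detseq_conj -detseq_mulmx !map_cat /mkseq -!map_comp.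
by congr (detseq (_ ++ _)); apply: eq_map => j;
  rewrite /= /upcol /downcol /entry_conj map_mxM !mulmxA (conj_expz Eu TE).
Qed.

(** For [sigma = 1] conjugation inverts [E], so the ascending run becomes descending and vice versa.
    Exchanging the blocks restores the shape of [cas] and produces the sign. *)
Lemma cas_conj_local k x y v : sigma = 1 -> (k <= n)%N -> T *m entry_conj y = tau *: v ->
  \det T * (cas E k x y)^* =
  tau ^+ (n - k) * (-1) ^+ (k * (n - k)) * cas E (n - k) v (T *m entry_conj x).
Proof.
move=> s1 lek yv; rewrite cas_conj yv s1.
set u := T *m entry_conj x.
have up : (fun j : nat => E ^ (- 1 * (- N%:Z + 2 * j%:Z)) *m u) =1 downcol E u.
  by move=> j; rewrite /downcol; congr (E ^ _ *m _); lia.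
have down : (fun j : nat => E ^ (- 1 * (N%:Z - 2 * j%:Z)) *m (tau *: v)) =1
    fun j => tau *: upcol E v j.
  by move=> j; rewrite /upcol -scalemxAr; congr (_ *: (E ^ _ *m _)); lia.
rewrite (eq_mkseq up) (eq_mkseq down) -[mkseq _ (n - k)]cats0 detseq_mkseqZ -mulrA.
congr (_ * _).
have /= -> := detseq_block [::] [::] (mkseq (downcol E u) k) (mkseq (upcol E v) (n - k)).
by rewrite !size_mkseq cats0 /cas subKn.
Qed.

(** For [sigma = -1] the runs keep their direction, so besides the exchange of blocks each run is
    reversed, whence the binomial signs. A reversed run starts at another power of [E]; the same
    [E ^ d] corrects both blocks. *)
Lemma cas_conj_nonlocal k x y v (d := 2 * (k%:Z - N.+1%:Z)) :
  sigma = -1 -> (k <= n)%N -> T *m entry_conj y = tau *: v ->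
  \det T * (cas E k x y)^* =
  tau ^+ (n - k) * (-1) ^+ (k * (n - k) + 'C(k, 2) + 'C(n - k, 2))
  * cas E (n - k) (E ^ d *m v) (E ^ d *m (T *m entry_conj x)).
Proof.
move=> s1 lek yv; rewrite cas_conj yv s1.
have down : (fun j : nat => E ^ (- -1 * (N%:Z - 2 * j%:Z)) *m (tau *: v)) =1
    fun j => tau *: downcol E v j.
  by move=> j; rewrite /downcol -scalemxAr; congr (_ *: (E ^ _ *m _)); lia.
set u := T *m entry_conj x.
have up : (fun j : nat => E ^ (- -1 * (- N%:Z + 2 * j%:Z)) *m u) =1 upcol E u.
  by move=> j; rewrite /upcol; congr (E ^ _ *m _); lia.
rewrite (eq_mkseq up) (eq_mkseq down) -[mkseq _ (n - k)]cats0 detseq_mkseqZ -!mulrA.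
congr (_ * _); rewrite /cas subKn //.
have -> : mkseq (downcol E (E ^ d *m u)) k = rev (mkseq (upcol E u) k).
  apply: (@eq_from_nth _ 0); rewrite ?size_rev ?size_mkseq // => j ltj.
  rewrite nth_rev ?size_mkseq // !nth_mkseq //; last by lia.
  by rewrite /upcol /downcol expzDmul // /d; congr (E ^ _ *m _); lia.
have -> : mkseq (upcol E (E ^ d *m v)) (n - k) = rev (mkseq (downcol E v) (n - k)).
  apply: (@eq_from_nth _ 0); rewrite ?size_rev ?size_mkseq // => j ltj.
  rewrite nth_rev ?size_mkseq // !nth_mkseq //; last by lia.
  rewrite /upcol /downcol expzDmul // /d; congr (E ^ _ *m _); lia.
have /= -> := detseq_block [::] [::] (mkseq (upcol E u) k) (mkseq (downcol E v) (n - k)).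
set s := mkseq (upcol E u) k; set t := mkseq _ (n - k).
have /= -> := detseq_rev [::] (rev s) t.
have := detseq_rev t [::] s; rewrite !cats0 => ->.
rewrite !size_mkseq !exprD !mulrA; congr (_ * _).
have sq m : (-1) ^+ m * (-1) ^+ m = 1 :> C by rewrite -exprD sign_double.
move: (sq 'C(k, 2)) (sq 'C(n - k, 2)).
move: ((-1) ^+ 'C(k, 2)) ((-1) ^+ 'C(n - k, 2)) => a b aa bb.
transitivity ((-1) ^+ (k * (n - k)) * (a * a) * (b * b)); last by ring.
by rewrite aa bb !mulr1.
Qed.

End Conjugation.

(** * The matrix exponential *)

(** Both sides run over the pairs with [i + j < k], by diagonals and by rows. *)
Lemma big_triangle (V : nmodType) (t : nat -> nat -> V) (k : nat) :
  \sum_(m < k) \sum_(i < m.+1) t (m - i)%N i = \sum_(i < k) \sum_(j < k - i) t j i.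
Proof.
elim: k => [|k IH]; first by rewrite !big_ord0.
rewrite big_ord_recr /= IH [RHS]big_ord_recr /= subSnn big_ord1.
rewrite [X in _ + X]big_ord_recr /= subnn addrA; congr (_ + _).
rewrite -big_split /=; apply: eq_bigr => i _.
by rewrite subSn ?(ltnW (ltn_ord i)) // big_ord_recr.
Qed.

(** By the binomial formula the truncated series of [x + y] collects the pairs [i + j < k] of the
    square, and the other pairs remain. The generality of an [algType] covers both the matrices and
    the real bound in [expmxD]. *)
Lemma exp_trunc_mul (F : numFieldType) (A : algType F) (x y : A) (k : nat) :
  GRing.comm x y ->
  let u z i := (i`!%:R^-1 : F) *: z ^+ i in
  (\sum_(j < k) u x j) * (\sum_(i < k) u y i) - \sum_(m < k) u (x + y) m
  = \sum_(i < k) \sum_(k - i <= j < k) u x j * u y i.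
Proof.
move=> cxy u.
have expand m : u (x + y) m = \sum_(i < m.+1) u x (m - i)%N * u y i.
  rewrite /u exprDn_comm // scaler_sumr; apply: eq_bigr => i _.
  have lei : (i <= m)%N by rewrite -ltnS.
  rewrite -scalerAl -scalerAr scalerA -[_ *+ 'C(_, _)]scaler_nat scalerA; congr (_ *: _).
  have fn0 j : (j`!%:R : F) != 0 by rewrite pnatr_eq0 -lt0n fact_gt0.
  apply: (mulfI (fn0 m)); rewrite mulrA mulfV // mul1r.
  rewrite -(bin_fact lei) !natrM; field; by rewrite !fn0.
rewrite (eq_bigr _ (fun (m : 'I_k) _ => expand m)).
rewrite (big_triangle (fun j i => u x j * u y i)).
apply/eqP; rewrite subr_eq -big_split /=; apply/eqP.
rewrite mulr_sumr; apply: eq_bigr => i _.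
rewrite mulr_suml -(big_mkord xpredT (fun j => u x j * u y i)).
rewrite (@big_cat_nat _ _ _ (k - i)%N) ?leq_subr //= addrC; congr (_ + _).
by rewrite big_mkord.
Qed.

Section MatrixExp.
Import numFieldTopology.Exports numFieldNormedType.Exports.
Local Open Scope classical_set_scope.

Lemma mx_norm_lim (K : numFieldType) (n : nat) (X : nat -> 'M[K]_n.+1) (L : 'M[K]_n.+1) :
  (forall e : K, 0 < e -> \forall k \near \oo, `|L - X k| < e) -> lim (X @ \oo) = L.
Proof.
by move=> XL; apply: cvg_lim; [exact: norm_hausdorff|apply/cvgrPdist_lt].
Qed.

Variables (R : realType) (n : nat).
Notation C := R[i].
Notation normc := (@ComplexField.Normc.normc R).
Notation M := 'M[C]_n.+1.
Implicit Types (A B L : M) (X Y : nat -> M).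

(** A real-valued submultiplicative norm ([nrmM]), so that real series control matrix series. *)
Definition nrm A : R := \sum_i \sum_j normc (A i j).

Lemma normc_ge0 (z : C) : 0 <= normc z.
Proof. by case: z => a b; apply: sqrtr_ge0. Qed.

Lemma norm_normc (z : C) : `|z| = (normc z)%:C. Proof. by []. Qed.

Lemma nrm_ge0 A : 0 <= nrm A.
Proof. by do 2![apply: sumr_ge0 => ? _]; apply: normc_ge0. Qed.

Lemma nrm_entry A i j : normc (A i j) <= nrm A.
Proof.
rewrite /nrm (bigD1 i) //= (bigD1 j) //= -addrA lerDl addr_ge0 //.
  by apply: sumr_ge0 => ? _; apply: normc_ge0.
by do 2![apply: sumr_ge0 => ? _]; apply: normc_ge0.
Qed.

Lemma nrmD A B : nrm (A + B) <= nrm A + nrm B.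
Proof.
rewrite /nrm -big_split; apply: ler_sum => i _; rewrite -big_split.
by apply: ler_sum => j _; rewrite mxE; apply: le_normcD.
Qed.

Lemma nrmZ a A : nrm (a *: A) = normc a * nrm A.
Proof.
rewrite /nrm mulr_sumr; apply: eq_bigr => i _; rewrite mulr_sumr.
by apply: eq_bigr => j _; rewrite mxE ComplexField.Normc.normcM.
Qed.

Lemma nrmN A : nrm (- A) = nrm A.
Proof.
by apply: eq_bigr => i _; apply: eq_bigr => j _; rewrite mxE normcN.
Qed.

Lemma nrm0 : nrm 0 = 0.
Proof.
by rewrite /nrm big1 // => i _; rewrite big1 // => j _; rewrite mxE ComplexField.Normc.normc0.
Qed.

Lemma nrm_sum (I : Type) (r : seq I) (P : pred I) (F : I -> M) :
  nrm (\sum_(i <- r | P i) F i) <= \sum_(i <- r | P i) nrm (F i).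
Proof.
elim/big_ind2: _ => //; first by rewrite nrm0.
by move=> x1 x2 y1 y2 h1 h2; apply: le_trans (nrmD _ _) (lerD h1 h2).
Qed.

Lemma nrmM A B : nrm (A * B) <= nrm A * nrm B.
Proof.
have normc_sum (F : 'I_n.+1 -> C) : normc (\sum_k F k) <= \sum_k normc (F k).
  elim/big_ind2: _ => //; first by rewrite ComplexField.Normc.normc0.
  by move=> x1 x2 y1 y2 h1 h2; apply: le_trans (le_normcD _ _) (lerD h1 h2).
apply: (@le_trans _ _ (\sum_i \sum_j \sum_k normc (A i k) * normc (B k j))).
  apply: ler_sum => i _; apply: ler_sum => j _; rewrite mxE.
  apply: le_trans (normc_sum _) _; apply: ler_sum => k _.
  by rewrite ComplexField.Normc.normcM.
rewrite /nrm mulr_suml; apply: ler_sum => i _.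
rewrite exchange_big /= mulr_suml; apply: ler_sum => k _.
rewrite -mulr_sumr ler_wpM2l ?normc_ge0 // [leRHS](bigD1 k) //= lerDl.
by do 2![apply: sumr_ge0 => ? _]; apply: normc_ge0.
Qed.

Lemma nrmX A k : nrm (A ^+ k) <= nrm 1 * nrm A ^+ k.
Proof.
elim: k => [|k IH]; first by rewrite !expr0 mulr1.
rewrite !exprSr mulrA; apply: le_trans (nrmM _ _) _.
by rewrite ler_wpM2r ?nrm_ge0.
Qed.

Lemma nrm_conj A : nrm (entry_conj A) = nrm A.
Proof.
apply: eq_bigr => i _; apply: eq_bigr => j _; rewrite mxE.
by case: (A i j) => a b; rewrite /= sqrrN.
Qed.

Lemma mx_norm_nrm A : mx_norm A <= (nrm A)%:C.
Proof.
have [->|/mx_norm_neq0[[i j] /= ->]] := eqVneq (mx_norm A) 0.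
  by rewrite lecR nrm_ge0.
by rewrite norm_normc lecR nrm_entry.
Qed.

Lemma squeeze0 (u e : nat -> R) :
  (forall k, 0 <= u k <= e k) -> e @ \oo --> 0 -> u @ \oo --> 0.
Proof. by move=> ue e0; apply: squeeze_cvgr (cvg_cst 0) e0; apply: nearW. Qed.

Definition cvgmx X L := (fun k => nrm (X k - L)) @ \oo --> 0.

Lemma cvgmx_le X L (e : nat -> R) :
  (forall k, nrm (X k - L) <= e k) -> e @ \oo --> 0 -> cvgmx X L.
Proof.
by move=> le; apply: squeeze0 => k; rewrite nrm_ge0 le.
Qed.

(** The topology behind [lim] is that of the maximum norm, which [nrm] dominates. *)
Lemma cvgmx_lim X L : cvgmx X L ->
  lim ((X : nat -> 'M[R[i] : numFieldType]_n.+1) @ \oo) = L.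
Proof.
move=> XL; apply: mx_norm_lim => e e0.
have /cvgrPdist_lt/(_ (complex.Re e)) := XL.
have Re0 : 0 < complex.Re e by move: e0; rewrite ltcE => /andP[].
have eE : e = (complex.Re e)%:C by rewrite RRe_real // gtr0_real.
move=> /(_ Re0); apply: filterS => k; rewrite sub0r normrN ger0_norm ?nrm_ge0 // => h.
rewrite -normrN opprB eE.
apply: le_lt_trans (_ : (nrm (X k - L))%:C < _); last by rewrite ltcR.
exact: mx_norm_nrm.
Qed.

Lemma cvgmx_uniq X L L' : cvgmx X L -> cvgmx X L' -> L = L'.
Proof. by move=> /cvgmx_lim <- /cvgmx_lim. Qed.

Lemma cvgmx_cst A : cvgmx (fun=> A) A.
Proof. by rewrite /cvgmx subrr nrm0; apply: cvg_cst. Qed.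

Lemma cvgmx_close X Y L : cvgmx X L -> (fun k => nrm (X k - Y k)) @ \oo --> 0 -> cvgmx Y L.
Proof.
move=> XL XY; apply: (@cvgmx_le _ _ (fun k => nrm (X k - L) + nrm (X k - Y k))).
  move=> k; have -> : Y k - L = (X k - L) + - (X k - Y k).
    by rewrite opprB [RHS]addrC addrA subrK.
  by apply: le_trans (nrmD _ _) _; rewrite nrmN.
by rewrite -[0]addr0; apply: cvgD.
Qed.

Lemma cvgmxM X Y L L' : cvgmx X L -> cvgmx Y L' -> cvgmx (fun k => X k * Y k) (L * L').
Proof.
move=> XL YL; apply: (@cvgmx_le _ _ (fun k => nrm (X k - L) * nrm (Y k - L')
   + (nrm (X k - L) * nrm L' + nrm L * nrm (Y k - L')))).
  move=> k; have -> : X k * Y k - L * L' =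
      (X k - L) * (Y k - L') + ((X k - L) * L' + L * (Y k - L')).
    by rewrite !mulrBl !mulrBr; apply/matrixP=> i j; rewrite !mxE; ring.
  apply: le_trans (nrmD _ _) _; apply: lerD; first exact: nrmM.
  by apply: le_trans (nrmD _ _) _; apply: lerD; apply: nrmM.
rewrite -[0](addr0 (0 : R)) -[X in _ --> X + _](mulr0 0); apply: cvgD; first exact: cvgM.
rewrite -[0](addr0 (0 : R)) -[X in _ --> X + _](mul0r (nrm L')).
rewrite -[X in _ --> _ + X](mulr0 (nrm L)).
by apply: cvgD; apply: cvgM => //; apply: cvg_cst.
Qed.

Lemma cvgmx_conj X L : cvgmx X L -> cvgmx (fun k => entry_conj (X k)) (entry_conj L).
Proof.
by move=> XL; apply: (cvgmx_le _ XL) => k; rewrite /entry_conj -map_mxB nrm_conj.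
Qed.

Definition expt A k : M := \sum_(i < k) (i`!)%:R^-1 *: A ^+ i.

Lemma cvg_sum0 (I : Type) (r : seq I) (f : I -> nat -> R) :
  (forall i, f i @ \oo --> 0) -> (fun k => \sum_(i <- r) f i k) @ \oo --> 0.
Proof.
move=> f0; elim: r => [|i r IH].
  by under eq_fun do rewrite big_nil; apply: cvg_cst.
under eq_fun do rewrite big_cons.
have := cvgD (f0 i) IH; rewrite addr0; exact.
Qed.

Lemma normr_Re_le (z : C) : `|complex.Re z| <= normc z.
Proof. by rewrite -lecR; apply: normc_ge_Re. Qed.

Lemma normr_Im_le (z : C) : `|complex.Im z| <= normc z.
Proof. by case: z => a b /=; rewrite -sqrtr_sqr ler_wsqrtr // lerDr sqr_ge0. Qed.

Lemma normc_le_ReIm (z : C) : normc z <= `|complex.Re z| + `|complex.Im z|.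
Proof.
case: z => a b /=; rewrite -[leRHS]ger0_norm ?addr_ge0 // -sqrtr_sqr ler_wsqrtr //.
by rewrite sqrrD !real_normK ?num_real // addrAC lerDl mulrn_wge0 // mulr_ge0.
Qed.

Lemma nrm_exp_term A k : nrm ((k`!)%:R^-1 *: A ^+ k) <= nrm (1 : M) * exp_coeff (nrm A) k.
Proof.
rewrite nrmZ ComplexField.Normc.normcV normcMn ComplexField.Normc.normc1.
rewrite /exp_coeff /= mulrC mulrA ler_wpM2r ?invr_ge0 ?ler0n //.
exact: nrmX.
Qed.

(** Absolute convergence by comparison with the real exponential series of [nrm A]. The function [h]
    stands for the real or imaginary part of an entry. *)
Lemma is_cvg_expt_part A (h : M -> R) :
  (forall B, `|h B| <= nrm B) -> cvgn (series (fun k => h ((k`!)%:R^-1 *: A ^+ k))).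
Proof.
move=> hle; apply: normed_cvg.
apply: (@series_le_cvg _ _ (nrm (1 : M) *: exp_coeff (nrm A))) => [k|k|k|] //=.
- by rewrite mulr_ge0 ?nrm_ge0 // exp_coeff_ge0 ?nrm_ge0.
- by apply: le_trans (hle _) (nrm_exp_term _ _).
- by apply: is_cvg_seriesZ; apply: is_cvg_series_exp_coeff.
Qed.

Lemma expt_cvg A : exists L, cvgmx (expt A) L.
Proof.
pose re (i j : 'I_n.+1) (k : nat) := complex.Re (((k`!)%:R^-1 *: A ^+ k) i j).
pose im (i j : 'I_n.+1) (k : nat) := complex.Im (((k`!)%:R^-1 *: A ^+ k) i j).
have cre i j : cvgn (series (re i j)).
  apply: (is_cvg_expt_part _ (h := fun B => complex.Re (B i j))) => B.
  exact: le_trans (normr_Re_le _) (nrm_entry _ _ _).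
have cim i j : cvgn (series (im i j)).
  apply: (is_cvg_expt_part _ (h := fun B => complex.Im (B i j))) => B.
  exact: le_trans (normr_Im_le _) (nrm_entry _ _ _).
exists (\matrix_(i, j) (limn (series (re i j)) +i* limn (series (im i j)))).
apply: (@cvgmx_le _ _ (fun k => \sum_i \sum_j
  (`|series (re i j) k - limn (series (re i j))|
   + `|series (im i j) k - limn (series (im i j))|))).
  move=> k; apply: ler_sum => i _; apply: ler_sum => j _.
  apply: le_trans (normc_le_ReIm _) _; rewrite !mxE summxE.
  have -> (F : 'I_k -> C) :
      \sum_i F i = (\sum_i complex.Re (F i)) +i* (\sum_i complex.Im (F i)).
    elim/big_ind3: _ => // [x1 x2 x3 y1 y2 y3 -> ->|l _]; first by [].
    by case: (F l).
  by rewrite !seriesEord.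
apply: cvg_sum0 => i; apply: cvg_sum0 => j.
have := cvgD ((norm_cvg0P _).2 ((subr_cvg0 _ _).2 (cre i j)))
  ((norm_cvg0P _).2 ((subr_cvg0 _ _).2 (cim i j))).
by rewrite addr0; exact.
Qed.

Lemma expmx_lim A L : cvgmx (expt A) L -> expmx A = L.
Proof. by move=> /cvgmx_lim <-; rewrite /expmx seriesEord. Qed.

Lemma cvg_expmx A : cvgmx (expt A) (expmx A).
Proof. by have [L AL] := expt_cvg A; rewrite (expmx_lim AL). Qed.

(* The product of the truncated exponentials minus the truncated exponential of
   the sum is dominated by the same expression in the reals nrm A and nrm B, so
   that expmxD follows from the real expRD. *)
Lemma expmxD A B : GRing.comm A B -> expmx (A + B) = expmx A * expmx B.
Proof.
move=> cAB; apply: expmx_lim.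
apply: cvgmx_close (cvgmxM (cvg_expmx A) (cvg_expmx B)) _.
set c := nrm (1 : M); set a := nrm A; set b := nrm B.
(* Each of the two factors of a term costs one [c] through [nrm_exp_term]. *)
apply: (@squeeze0 _ (fun k => c ^+ 2 *
  (series (exp_coeff a) k * series (exp_coeff b) k - series (exp_coeff (a + b)) k))); last first.
  rewrite -(mulr0 (c ^+ 2)) -(subrr (expR (a + b))) {1}expRD.
  apply: cvgM; first exact: cvg_cst.
  apply: cvgB; last exact: is_cvg_series_exp_coeff.
  by apply: cvgM; apply: is_cvg_series_exp_coeff.
move=> k; rewrite nrm_ge0 /= /expt.
rewrite (exp_trunc_mul k cAB) !seriesEord.
have trunc := @exp_trunc_mul R R^o a b k (mulrC a b).
have uE (z : R^o) i : (i`!%:R^-1 : R) *: z ^+ i = exp_coeff z i.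
  by rewrite /exp_coeff /= mulrC.
have -> : [sequence \sum_(i < m) exp_coeff a i]_m k
      * [sequence \sum_(i < m) exp_coeff b i]_m k
    - [sequence \sum_(i < m) exp_coeff (a + b) i]_m k =
    \sum_(i < k) \sum_(k - i <= j < k) exp_coeff a j * exp_coeff b i.
  rewrite /=; under [RHS]eq_bigr do under eq_bigr do rewrite -!uE.
  rewrite -[RHS]trunc /=; congr (_ * _ - _); apply: eq_bigr => i _; exact/esym/uE.
rewrite mulr_sumr; apply: le_trans (nrm_sum _ _ _) _; apply: ler_sum => i _.
rewrite mulr_sumr; apply: le_trans (nrm_sum _ _ _) _; apply: ler_sum => j _.
apply: le_trans (nrmM _ _) _; rewrite expr2 mulrACA.
by apply: ler_pM; rewrite ?nrm_ge0 ?nrm_exp_term.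
Qed.

Lemma expmx0 : expmx (0 : M) = 1.
Proof.
(* The partial sum of length 0 is empty and misses the identity; all later ones are exact. *)
apply: expmx_lim; apply: (@cvgmx_le _ _ (fun k => nrm (1 : M) *+ (k == 0)%N)) => [k|].
  rewrite /expt; case: k => [|k]; first by rewrite big_ord0 sub0r nrmN.
  rewrite big_ord_recl expr0 invr1 scale1r big1 ?addr0 ?subrr ?nrm0 // => i _.
  by rewrite expr0n scaler0.
apply: (@cvg_trans _ ((fun=> 0 : R) @ \oo)); last exact: cvg_cst.
by apply: near_eq_cvg; near=> k; rewrite gtn_eqF //; near: k; exists 1%N.
Unshelve. all: by end_near. Qed.

Lemma expmxNK A : expmx (- A) * expmx A = 1.
Proof. by rewrite -expmxD ?addNr ?expmx0 //; apply: commr_sym; apply: commrN. Qed.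

Lemma expmx_unit A : expmx A \is a GRing.unit.
Proof.
apply/unitrP; exists (expmx (- A)); split; first exact: expmxNK.
by have := expmxNK (- A); rewrite opprK.
Qed.

Lemma expmxN A : expmx (- A) = (expmx A)^-1.
Proof. by apply: (mulIr (expmx_unit A)); rewrite expmxNK mulVr ?expmx_unit. Qed.

Lemma expmxMn A k : expmx (A *+ k) = expmx A ^+ k.
Proof.
elim: k => [|k IH]; first exact: expmx0.
rewrite mulrS expmxD ?IH -?exprS //; exact: commrMn.
Qed.

Lemma expmxMz A (z : int) : expmx (A *~ z) = expmx A ^ z.
Proof.
case: z => k; first by rewrite -pmulrn expmxMn.
by rewrite NegzE mulrNz -pmulrn expmxN expmxMn exprnN.
Qed.

Lemma expmx_intertwine (T A B : M) : T * A = B * T -> T * expmx A = expmx B * T.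
Proof.
move=> TAB; have h k : T * expt A k = expt B k * T.
  rewrite /expt mulr_sumr mulr_suml; apply: eq_bigr => i _.
  rewrite -scalerAr -scalerAl; congr (_ *: _).
  elim: (i : nat) => [|j IH]; first by rewrite !expr0 mulr1 mul1r.
  by rewrite exprS mulrA TAB -mulrA IH mulrA -exprS.
apply: (@cvgmx_uniq (fun k => T * expt A k)).
  by apply: cvgmxM (cvgmx_cst T) (cvg_expmx A).
by rewrite (funext h); apply: cvgmxM (cvg_expmx B) (cvgmx_cst T).
Qed.

Lemma expmx_conj A : expmx (entry_conj A) = entry_conj (expmx A).
Proof.
apply: expmx_lim; have := cvgmx_conj (cvg_expmx A); congr cvgmx.
apply/funext => k; rewrite /expt /entry_conj raddf_sum; apply: eq_bigr => i _ /=.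
by rewrite map_mxZ rmorphXn fmorphV rmorph_nat.
Qed.

End MatrixExp.

(** * Uniqueness of square roots *)

Section Sylvester.
Variables (C : numClosedFieldType) (n : nat).
Notation M := 'M[C]_n.+1.
Implicit Types A B X S : M.

Lemma unit_sub_scalar A (z : C) : ~~ eigenvalue A z -> A - z%:M \in unitmx.
Proof.
by rewrite /eigenvalue negbK kermx_eq0 -row_free_unit.
Qed.

Lemma eigenvalueN A z : eigenvalue (- A) z -> eigenvalue A (- z).
Proof.
move=> /eigenvalueP[v vA v0]; apply/eigenvalueP; exists v => //.
by rewrite scaleNr -vA mulmxN opprK.
Qed.

(** As [A X = X (-B)], the characteristic polynomial [chi] of [A] gives [chi(A) X = X chi(-B)]. The
    left side vanishes by Cayley-Hamilton, and [chi(-B)] is invertible because no root of [chi] is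
    an eigenvalue of [-B]. *)
Lemma sylvester_eq0 A B X : A * X = - (X * B) ->
  (forall s, eigenvalue A s -> ~~ eigenvalue B (- s)) -> X = 0.
Proof.
move=> AX disj; have [r rE] := closed_field_poly_normal (char_poly A).
rewrite (monicP (char_poly_monic A)) scale1r in rE.
have inter (s : seq C) :
    (\prod_(z <- s) (A - z%:M)) * X = X * \prod_(z <- s) (- B - z%:M).
  elim: s => [|z s IH]; first by rewrite !big_nil mul1r mulr1.
  rewrite !big_cons -mulrA IH !mulrA; congr (_ * _).
  rewrite mulrBl mulrBr AX mulrN; congr (_ - _); exact/esym/scalar_mxC.
have A0 : \prod_(z <- r) (A - z%:M) = 0.
  rewrite -[RHS](Cayley_Hamilton A) rE rmorph_prod; apply: eq_bigr => z _.
  by rewrite rmorphB /= horner_mx_X horner_mx_C.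
have Bu : \prod_(z <- r) (- B - z%:M) \is a GRing.unit.
  rewrite big_seq; apply: rpred_prod => z zr.
  apply: unit_sub_scalar; apply/negP => /eigenvalueN; apply/negP/disj.
  by rewrite eigenvalue_root_char rE root_prod_XsubC.
by apply: (mulIr Bu); rewrite -inter A0 !mul0r.
Qed.

Lemma eigenvalue_conj A z : eigenvalue (entry_conj A) z -> eigenvalue A z^*.
Proof.
have K m p (B : 'M[C]_(m, p)) : entry_conj (entry_conj B) = B.
  by apply/matrixP => i j; rewrite !mxE conjCK.
move=> /eigenvalueP[v vA v0]; apply/eigenvalueP; exists (entry_conj v).
  by rewrite -[A]K /entry_conj -map_mxM vA map_mxZ.
by apply: contraNneq v0 => v0; rewrite -[v]K v0 /entry_conj map_mx0.
Qed.

Lemma eigenvalueV A z : A \is a GRing.unit -> eigenvalue A^-1 z ->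
  z != 0 /\ eigenvalue A z^-1.
Proof.
move=> Au /eigenvalueP[v vA v0].
have vE : v = z *: (v *m A).
  by rewrite scalemxAl -vA -mulmxA -[_ *m A]/(_ * A) mulVr ?mulmx1.
have z0 : z != 0 by apply: contraNneq v0 => z0; rewrite vE z0 scale0r.
split=> //; apply/eigenvalueP; exists v => //.
by rewrite {2}vE scalerA mulVf ?scale1r.
Qed.

Lemma eigenvalue_sqr S z : eigenvalue S z -> eigenvalue (S * S) (z ^+ 2).
Proof.
move=> /eigenvalueP[v vS v0]; apply/eigenvalueP; exists v => //.
by rewrite -[S * S]/(S *m S) mulmxA vS -scalemxAl vS scalerA.
Qed.

End Sylvester.

(** * Square roots with principal spectrum *)

Section SquareRoot.
Variables (R : realType) (n : nat).
Notation M := 'M[R[i]]_n.+1.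
Implicit Types A S T : M.

Definition principal_spectrum S := forall s : R[i], eigenvalue S s ->
  0 < complex.Re s \/ (complex.Re s = 0 /\ 0 < complex.Im s).

(** The defect [X = S T - T S'] satisfies [S X = - X S'], so [sylvester_eq0] applies. *)
Lemma sqrtmx_intertwine S S' T : S * S * T = T * (S' * S') ->
  (forall s, eigenvalue S s -> ~~ eigenvalue S' (- s)) -> S * T = T * S'.
Proof.
move=> ST disj; apply/eqP; rewrite -subr_eq0; apply/eqP.
apply: sylvester_eq0 disj.
by rewrite mulrBr mulrBl opprB !mulrA ST !mulrA.
Qed.

Lemma sqrtmx_comm S A : principal_spectrum S -> GRing.comm (S * S) A -> GRing.comm S A.
Proof.
move=> Sp SA; apply: sqrtmx_intertwine => // s /Sp h; apply/negP => /Sp.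
rewrite !raddfN /=; lra.
Qed.

Lemma sqrtmx_conj_local S T : principal_spectrum S -> S \is a GRing.unit ->
  T = S * S * T * (entry_conj S * entry_conj S) -> T * entry_conj S = S^-1 * T.
Proof.
move=> Sp Su ST; apply/esym/sqrtmx_intertwine.
  by rewrite [in LHS]ST !mulrA mulrVK // mulVr // mul1r.
move=> s /(eigenvalueV Su)[s0 /Sp]; set t := s^-1 => tp; apply/negP => /eigenvalue_conj.
set u := (- s)^* => /Sp up.
(* Both [t] and [u] are eigenvalues of [S], with arguments in ]-pi/2, pi/2], whereas this equation
   would make their arguments differ by pi. The four cases below check this on real and imaginary
   parts. *)
have ut : u * t^* = -1 by rewrite -rmorphM mulNr mulfV // rmorphN rmorph1.
move: ut tp up; case: u => c d; case: t => a b /= [].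
rewrite oppr0 => h1 h2 [a0|[a0 b0]] [c0|[c0 d0]].
- have : a * (c * a - d * - b) =
      a * (c * a) + c * b ^+ 2 + b * (c * - b + d * a) by ring.
  have := mulr_gt0 a0 (mulr_gt0 c0 a0); have := mulr_ge0 (ltW c0) (sqr_ge0 b).
  rewrite h1 h2; lra.
- by have := mulr_gt0 d0 a0; move: h2; rewrite c0; lra.
- by have := mulr_gt0 c0 b0; move: h2; rewrite a0; lra.
- by have := mulr_gt0 d0 b0; move: h1; rewrite a0; lra.
Qed.

(* Re s > 0 is stable under s |-> s^*, but s^* = - s on the imaginary axis: the
   hypothesis on negative eigenvalues removes exactly this case. *)
Lemma sqrtmx_conj_nonlocal S T : principal_spectrum S ->
  (forall a : R[i], eigenvalue (S * S) a -> ~~ (a < 0)) ->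
  S * S * T = T * (entry_conj S * entry_conj S) -> S * T = T * entry_conj S.
Proof.
move=> Sp cut ST; apply: (sqrtmx_intertwine ST) => s eS; have sp := Sp s eS.
apply/negP => /eigenvalue_conj /Sp.
have := cut _ (eigenvalue_sqr eS); move: sp; case: s {eS} => a b /= sp.
rewrite ltcE /= negb_and -leNgt => sq up.
(* [s] and [(- s)^*] have opposite real parts and equal imaginary parts. If both are principal, [s]
   is purely imaginary and its square is a negative eigenvalue of [S * S]. *)
have [a0 b0] : a = 0 /\ 0 < b by case: sp up => [?|[? ?]] [?|[? ?]]; split => //; lra.
move: sq; rewrite a0 !mul0r !mulr0 addr0 eqxx /= sub0r oppr_ge0.
by rewrite leNgt mulr_gt0.
Qed.

End SquareRoot.

(** * The double Casoratian solution *)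

Lemma casoratianE (R : realType) (N k : nat) (Gamma : 'M[R[i]]_N.*2.+2)
    (x y : 'cV[R[i]]_N.*2.+2) :
  (k <= N.*2.+2)%N -> casoratian k Gamma x y = cas (expmx Gamma) k x y.
Proof.
move=> lek; rewrite /cas /detseq size_cat !size_mkseq subnKC // eqxx.
congr (\det _); apply/matrixP => i j; rewrite !mxE nth_cat size_mkseq.
case: ltnP => [lt|ge]; rewrite nth_mkseq ?expmxMz ?/upcol ?/downcol ?mxE //.
by rewrite ltn_sub2r // (leq_ltn_trans ge).
Qed.

Lemma divr_mul_eq (A : unitRingType) (a b z e x y : A) :
  b \is a GRing.unit -> e \is a GRing.unit ->
  a * z = x * e -> b * z = y * e -> a / b * y = x.
Proof.
move=> bu eu az bz; apply: (mulIr eu).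
by rewrite -mulrA -bz mulrA mulrVK.
Qed.

Lemma comm_div_eq (A : unitRingType) (d e x y : A) :
  y \is a GRing.unit -> GRing.comm e x -> GRing.comm e y -> d * y = x -> GRing.comm d e.
Proof.
move=> yu ex ey dy; apply: (mulIr yu).
by rewrite -mulrA ey mulrA dy -ex -dy mulrA.
Qed.

(** * The dispersion matrix in terms of the exponential *)

Section Dispersion.
Variables (R : realType) (n : nat) (Gamma : 'M[R[i]]_n.+1) (delta epsilon : R).
Notation E := (expmx Gamma).
Notation de := ((delta * epsilon)%:C).
Notation p := (4 + de).
Notation q := (4 - de).
Hypothesis coth_def : expmx (Gamma *+ 2) - 1 \in unitmx.

Lemma expmx2 : expmx (Gamma *+ 2) = E * E.
Proof. by rewrite expmxMn. Qed.

Lemma scaler_combine (L : lmodType R[i]) (a b : R[i]) (y z : L) :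
  a *: (y - z) + b *: (y + z) = (a + b) *: y - (a - b) *: z.
Proof. by rewrite scalerBr scalerDr scalerBl scalerDl opprB addrACA [- _ + _]addrC. Qed.

Lemma mul_expmx_combine (a b : R[i]) : (a *: E - b *: E^-1) * E = a *: (E * E) - b *: 1.
Proof. by rewrite mulrBl -!scalerAl mulVr ?expmx_unit. Qed.

(** Clearing the hyperbolic cotangent leaves [4 (E^2 - 1) + de (E^2 + 1) = p E^2 - q]; changing the
    sign of [de] exchanges [p] and [q], which gives [dispersion_den]. *)
Lemma dispersion_num : (4%:M + de *: cothmx Gamma) * (expmx (Gamma *+ 2) - 1) =
  (p *: E - q *: E^-1) * E.
Proof.
rewrite mulrDl -scalerAl divrK // expmx2 -[4%:M * _]/(4%:M *m _) mul_scalar_mx.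
by rewrite scaler_combine mul_expmx_combine.
Qed.

Lemma dispersion_den : (4%:M - de *: cothmx Gamma) * (expmx (Gamma *+ 2) - 1) =
  (q *: E - p *: E^-1) * E.
Proof.
rewrite -scaleNr mulrDl -scalerAl divrK // expmx2 -[4%:M * _]/(4%:M *m _) mul_scalar_mx.
by rewrite scaler_combine opprK mul_expmx_combine.
Qed.

Lemma dispersion_num_unit : 4%:M + de *: cothmx Gamma \in unitmx ->
  p *: E - q *: E^-1 \is a GRing.unit.
Proof.
move=> u; rewrite -(unitrMl _ (expmx_unit Gamma)) -dispersion_num.
rewrite (unitrMl _ (coth_def : _ \is a GRing.unit)).
exact: u.
Qed.

Lemma dispersion_den_unit : 4%:M - de *: cothmx Gamma \in unitmx ->
  q *: E - p *: E^-1 \is a GRing.unit.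
Proof.
move=> u; rewrite -(unitrMl _ (expmx_unit Gamma)) -dispersion_den.
rewrite (unitrMl _ (coth_def : _ \is a GRing.unit)).
exact: u.
Qed.

Lemma dispersionE : 4%:M - de *: cothmx Gamma \in unitmx ->
  dispersion delta epsilon Gamma * (q *: E - p *: E^-1) = p *: E - q *: E^-1.
Proof.
move=> u; exact: divr_mul_eq u (expmx_unit Gamma) dispersion_num dispersion_den.
Qed.

Lemma dispersion_comm : 4%:M - de *: cothmx Gamma \in unitmx ->
  GRing.comm (dispersion delta epsilon Gamma) E.
Proof.
move=> u; have Qu := dispersion_den_unit u.
have cE a b : GRing.comm E (a *: E - b *: E^-1).
  rewrite /GRing.comm mulrBr mulrBl -!scalerAr -!scalerAl.
  by rewrite mulrV ?mulVr ?expmx_unit.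
exact: comm_div_eq Qu (cE p q) (cE q p) (dispersionE u).
Qed.

End Dispersion.

(** * Lattice shifts and conjugation of the solution *)

Section Solution.
Variables (K : numClosedFieldType) (N : nat).
Notation n := N.*2.+2.
Variables (E S T : 'M[K]_n) (c : 'cV[K]_n) (sigma eta : int) (tau : K).
Hypothesis Eu : E \is a GRing.unit.
Hypothesis Su : S \is a GRing.unit.
Hypothesis cSE : GRing.comm S E.
Hypothesis sigma1 : sigma = 1 \/ sigma = -1.
Hypothesis TE : T *m entry_conj E = E ^ (- sigma) *m T.
Hypothesis TS : T *m entry_conj S = S ^ (- sigma) *m T.

Definition phi (a b : int) : 'cV[K]_n := E ^ a *m (S ^ b *m c).
Definition psi (a b : int) : 'cV[K]_n := T *m entry_conj (phi (sigma * a) (sigma * b)).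

Notation F a b := (cas E N.+1 (phi a b) (psi a b)).
Notation G a b := (cas E N.+2 (phi a b) (psi a b)).
Notation H a b := (cas E N (phi a b) (psi a b)).

Lemma sigma_sq z : sigma * (sigma * z) = z.
Proof. by case: sigma1 => ->; rewrite mulrA ?mulN1r ?opprK !mul1r. Qed.

Lemma comm_expz (a b : int) : S ^ b *m E ^ a = E ^ a *m S ^ b.
Proof. by apply: commrXz; apply: commr_sym; apply: commrXz; apply: commr_sym. Qed.

(** The lattice reflection multiplies exponents by [sigma] and the intertwining by [- sigma]; as
    [sigma] squares to 1, [psi] evolves by [E^-1] and [S^-1] in the local and nonlocal cases
    alike. *)
Lemma psiE a b : psi a b = E ^ (- a) *m (S ^ (- b) *m (T *m entry_conj c)).
Proof.
have sK z : - sigma * (sigma * z) = - z by rewrite mulNr sigma_sq.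
rewrite /psi /phi /entry_conj !map_mxM mulmxA (conj_expz Eu TE) sK -!mulmxA.
by congr (_ *m _); rewrite mulmxA (conj_expz Su TS) sK mulmxA.
Qed.

Lemma phiS1 a b : phi (a + 1) b = E *m phi a b.
Proof. by rewrite /phi addrC exprzDr // -mulmxA. Qed.

Lemma phiS2 a b : phi a (b + 1) = S *m phi a b.
Proof.
have cS : S *m E ^ a = E ^ a *m S by exact: (comm_expz a 1).
by rewrite /phi [b + 1]addrC exprzDr // [RHS]mulmxA cS -!mulmxA.
Qed.

Lemma psiS1 a b : psi (a + 1) b = E^-1 *m psi a b.
Proof. by rewrite !psiE opprD addrC exprzDr // -mulmxA. Qed.

Lemma psiS2 a b : psi a (b + 1) = S^-1 *m psi a b.
Proof.
have cS : S^-1 *m E ^ (- a) = E ^ (- a) *m S^-1 by exact: (comm_expz (- a) (-1)).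
by rewrite !psiE opprD [- b + _]addrC exprzDr // [RHS]mulmxA cS -!mulmxA.
Qed.

Lemma cas_toda_lattice a b : F a b ^+ 2 + G a b * H a b = F (a + 1) b * F (a - 1) b.
Proof.
rewrite (cas_toda Eu) phiS1 psiS1; congr (_ * cas E _ _ _).
  by rewrite -[in RHS](mulKmx Eu (phi (a - 1) b)) -phiS1 subrK.
by rewrite -[in RHS](mulKVmx Eu (psi (a - 1) b)) -psiS1 subrK.
Qed.

Lemma cas_bilinear_lattice p q a b :
  let P := p *: E - q *: E^-1 in let Q := q *: E - p *: E^-1 in
  P \is a GRing.unit -> S *m (S *m Q) = P ->
  q * (G a b * F (a + 1) (b + 1) + G (a + 1) (b + 1) * F a b)
  = p * (G (a + 1) b * F a (b + 1) + G a (b + 1) * F (a + 1) b).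
Proof.
move=> P Q Pu SQ; rewrite !phiS1 !psiS1 !phiS2 !psiS2.
exact: cas_bilinear.
Qed.

Hypothesis TT : T *m entry_conj T = tau%:M.

Lemma conj_psi a b : T *m entry_conj (psi (sigma * a) (sigma * b)) = tau *: phi a b.
Proof.
have eK m k (A : 'M[K]_(m, k)) : entry_conj (entry_conj A) = A.
  by apply/matrixP => i j; rewrite !mxE conjCK.
rewrite {1}/psi !sigma_sq {1}/entry_conj map_mxM -!/(entry_conj _) eK.
by rewrite mulmxA TT mul_scalar_mx.
Qed.

Hypothesis Tu : T \is a GRing.unit.
Hypothesis tau_neq0 : tau != 0.
Hypothesis eta1 : eta = 1 \/ eta = -1.
Hypothesis tauE : if sigma == 1 then tau = - eta%:~R else tau = eta%:~R * \det E ^+ 2.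

(** Conjugation exchanges the block sizes, which sends [F] to [F] and [G] to [H]. The prescribed
    [tau] is what makes the two constants agree up to [eta]. *)
Lemma cas_conj_refl : exists2 k : K, k != 0 & forall a b,
  (F (sigma * a) (sigma * b))^* = k * F a b /\
  (G (sigma * a) (sigma * b))^* = k * (eta%:~R * H a b).
Proof.
have Td : \det T != 0 by rewrite -unitfE -unitmxE.
have d1 : (n - N.+1)%N = N.+1 by lia.
have d2 : (n - N.+2)%N = N by lia.
have l1 : (N.+1 <= n)%N by lia.
have l2 : (N.+2 <= n)%N by lia.
(* Forced by [F]: the [N.+1] columns of its second block give [tau] each, and the exchange of blocks
   gives the sign. *)
exists ((- tau) ^+ N.+1 / \det T) => [|a b].
  by rewrite mulf_neq0 ?invr_eq0 // expf_neq0 // oppr_eq0.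
have sgn k : (-1) ^+ (k * k) = (-1) ^+ k :> K.
  by rewrite -signr_odd oddM andbb signr_odd.
have eta2 : eta%:~R * eta%:~R = 1 :> K.
  by case: eta1 => ->; rewrite ?mulr1 // mulrNN mulr1.
have sgn2 k : (-1) ^+ (k.+2 * k) = (-1) ^+ k :> K.
  by rewrite -signr_odd oddM /= negbK andbb signr_odd.
have dT (z t : K) : \det T * z = t -> z = t / \det T.
  by move=> <-; rewrite mulrAC mulfV ?mul1r.
have [s1|s1] := sigma1; move: tauE; rewrite {1}s1 ?eqxx => tE.
- have /dT -> := cas_conj_local Eu TE (phi (sigma * a) (sigma * b)) s1 l1 (conj_psi a b).
  have /dT -> := cas_conj_local Eu TE (phi (sigma * a) (sigma * b)) s1 l2 (conj_psi a b).
  rewrite d1 d2 sgn sgn2 -!/(entry_conj _) -!/(psi a b).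
  split; first by rewrite [(- tau) ^+ _]exprNn; ring.
  (* Inserting [eta] squared supplies the missing power of [tau], since [- tau * eta = 1] here. *)
  transitivity ((- 1) ^+ N * tau ^+ N * (eta%:~R * eta%:~R) * H a b / \det T).
    by rewrite eta2; ring.
  by rewrite [(- tau) ^+ _]exprNn !exprS; move: (tau ^+ N) => t; rewrite tE; ring.
have sN : (-1 == 1 :> int) = false by [].
rewrite sN in tE.
have /dT -> := cas_conj_nonlocal Eu TE (phi (sigma * a) (sigma * b)) s1 l1 (conj_psi a b).
have /dT -> := cas_conj_nonlocal Eu TE (phi (sigma * a) (sigma * b)) s1 l2 (conj_psi a b).
rewrite d1 d2 -!/(entry_conj _) -!/(psi a b) subrr mulr0 !expr0z !mul1mx.
(* For [G] both blocks are shifted by [E ^ 2], and the resulting [\det E ^+ 2] is the one contained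
   in [tau]. *)
have -> : 2 * (N.+2%:Z - N.+1%:Z) = 2 by lia.
have E2 (z : 'cV[K]_n) : E ^ 2 *m z = E *m (E *m z) by rewrite mulmxA.
have cEE : GRing.comm E E by [].
rewrite !E2 !cas_comm // -addnA exprD sgn addnn -mul2n exprM sqrrN !expr1n mulr1.
split; first by rewrite [(- tau) ^+ _]exprNn; ring.
have -> : (-1) ^+ (N.+2 * N + 'C(N.+2, 2) + 'C(N, 2)) = (-1) ^+ N.+1 :> K.
  rewrite binS bin1 binS bin1 -[in LHS]signr_odd -[in RHS]signr_odd !oddD oddM /=.
  by case: (odd N); case: (odd 'C(N, 2)).
transitivity ((- 1) ^+ N.+1 * tau ^+ N * (eta%:~R * eta%:~R) * \det E ^+ 2
  * H a b / \det T).
  by rewrite eta2; ring.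
by rewrite [(- tau) ^+ _]exprNn !exprS; move: (tau ^+ N) => t; rewrite tE; ring.
Qed.

End Solution.

Lemma conj_expmx_intertwine (R : realType) (n : nat) (Gamma T : 'M[R[i]]_n.+1) (sigma : int) :
  sigma = 1 \/ sigma = -1 ->
  Gamma *m T + sigma%:~R *: (T *m entry_conj Gamma) = 0 ->
  T *m entry_conj (expmx Gamma) = expmx Gamma ^ (- sigma) *m T.
Proof.
move=> s1 GT; rewrite -expmx_conj -expmxMz; apply: expmx_intertwine.
case: s1 GT => ->.
  rewrite scale1r => /eqP; rewrite addrC addr_eq0 => /eqP TG.
  by rewrite [LHS]TG mulrN1z mulNr.
by rewrite scaleN1r => /eqP; rewrite subr_eq0 => /eqP GT; rewrite -[LHS]GT opprK mulr1z.
Qed.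

(** * Conjugation of the square root *)

Section SqrtIntertwine.
Variables (R : realType) (n : nat) (E S T : 'M[R[i]]_n.+1) (p q : R[i]) (sigma : int).
Let P := p *: E - q *: E^-1.
Let Q := q *: E - p *: E^-1.
Hypothesis Eu : E \is a GRing.unit.
Hypothesis Su : S \is a GRing.unit.
Hypothesis Qu : Q \is a GRing.unit.
Hypothesis pR : p^* = p.
Hypothesis qR : q^* = q.
Hypothesis SQ : S * S * Q = P.
Hypothesis Sp : principal_spectrum S.
Hypothesis sigma1 : sigma = 1 \/ sigma = -1.
Hypothesis TE : T *m entry_conj E = E ^ (- sigma) *m T.
Hypothesis cut : sigma = -1 -> forall a : R[i], eigenvalue (S * S) a -> ~~ (a < 0).

(** Since [p] and [q] are real, moving the conjugates of [P] and [Q] past [T] gives [- Q] and [- P]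
    for [sigma = 1], and [P] and [Q] for [sigma = -1]. This settles the claim for [S * S], the
    quotient of [P] by [Q], and the principal spectrum passes it on to [S]. *)
Lemma conj_sqrtmx_intertwine : T *m entry_conj S = S ^ (- sigma) *m T.
Proof.
have conjE (x y : R[i]) : x^* = x -> y^* = y ->
    T * entry_conj (x *: E - y *: E^-1) = (x *: E ^ (- sigma) - y *: E ^ sigma) * T.
  move=> xR yR; rewrite /entry_conj map_mxB !map_mxZ /= xR yR.
  rewrite mulrBr mulrBl -!scalerAr -!scalerAl.
  have TEz := conj_expz Eu TE.
  have := TEz 1; have := TEz (-1); rewrite mulrN1 opprK mulr1 => h1 h2.
  by congr (_ *: _ - _ *: _).
have cQu : entry_conj Q \is a GRing.unit by apply: rmorph_unit.
have conjSQ : entry_conj S * entry_conj S * entry_conj Q = entry_conj P.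
  by rewrite -SQ /entry_conj !map_mxM.
have cP := conjE _ _ pR qR; have cQ := conjE _ _ qR pR.
case: sigma1 => s1; rewrite s1 ?opprK in cP cQ *.
  apply: (sqrtmx_conj_local Sp Su).
  apply: (mulIr cQu); rewrite -[RHS]mulrA conjSQ -[RHS]mulrA cP cQ.
  have -> : p *: E ^ (-1) - q *: E ^ 1 = - Q by rewrite opprB.
  have -> : q *: E ^ (-1) - p *: E ^ 1 = - P by rewrite opprB.
  by rewrite !mulNr mulrN mulrA SQ.
apply: esym; rewrite expr1z; apply: (sqrtmx_conj_nonlocal Sp (cut s1)).
apply: (mulIr cQu); rewrite -[RHS]mulrA conjSQ -[LHS]mulrA cP cQ mulrA.
by rewrite -/Q SQ.
Qed.

End SqrtIntertwine.

(** The first equation regroups as [4 - de] times the sum of [u] over one diagonal of the cell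
    equals [4 + de] times [w] times the sum over the other; clearing denominators gives the second
    bilinear identity. The constant [k] cancels in all quotients. *)
Lemma sine_gordon_of_bilinear (R : realType) (eta sigma : int) (delta epsilon : R)
    (k : R[i]) (f g h : int -> int -> R[i]) :
  eta = 1 \/ eta = -1 -> sigma = 1 \/ sigma = -1 -> epsilon != 0 -> k != 0 ->
  (forall a b, f a b != 0) ->
  (forall a b, f a b ^+ 2 + g a b * h a b = f (a + 1) b * f (a - 1) b) ->
  (forall a b, (4 - (delta * epsilon)%:C) *
      (g a b * f (a + 1) (b + 1) + g (a + 1) (b + 1) * f a b)
    = (4 + (delta * epsilon)%:C) *
      (g (a + 1) b * f a (b + 1) + g a (b + 1) * f (a + 1) b)) ->
  (forall a b, conj_refl sigma f a b = k * f a b) ->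
  (forall a b, conj_refl sigma g a b = k * (eta%:~R * h a b)) ->
  discrete_sine_gordon eta sigma delta epsilon
    (fun a b => (epsilon%:C)^-1 * g a b / f a b) (cell_ratio f).
Proof.
move=> eta1 sigma1 eps0 k0 f0 step latt fc gc.
have e0 : epsilon%:C != 0 by rewrite fmorph_eq0.
have eR : Num.conj (epsilon%:C : R[i]) = epsilon%:C := conjc_real _.
have eta2 : eta%:~R ^+ 2 = 1 :> R[i] by case: eta1 => ->; rewrite ?sqrrN expr1n.
pose u a b := (epsilon%:C)^-1 * g a b / f a b; rewrite -/u.
have uc a b : conj_refl sigma u a b = (epsilon%:C)^-1 * (eta%:~R * h a b) / f a b.
  have -> : conj_refl sigma u a b =
      (epsilon%:C)^-1 * conj_refl sigma g a b / conj_refl sigma f a b.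
    by rewrite /conj_refl /u !rmorphM !fmorphV /= eR.
  by rewrite fc gc; field; rewrite f0 k0 e0.
(* Here [eta] enters squared, and the first bilinear identity leaves values of [f] alone; the second
   equation then compares two quotients of such values. *)
have factor a b : 1 + eta%:~R * epsilon%:C ^+ 2 * u a b * conj_refl sigma u a b =
    f (a + 1) b * f (a - 1) b / f a b ^+ 2.
  rewrite -step uc /u mulrDl mulfV ?expf_neq0 //; congr (1 + _).
  transitivity (eta%:~R ^+ 2 * (g a b * h a b / f a b ^+ 2)); last by rewrite eta2 mul1r.
  by field; rewrite f0 e0.
move=> /= n m; split.
- apply/eqP; rewrite -subr_eq0; apply/eqP.
  rewrite -[RHS](mulr0 ((epsilon%:C)^-1 / (f n m * f (n + 1) (m + 1)))).
  have /eqP := latt n m; rewrite -subr_eq0 => /eqP <-.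
  rewrite /u /cell_ratio; move: (delta * epsilon)%:C => de.
  by field; rewrite !f0 e0.
- rewrite !factor /cell_ratio subrK; by field; rewrite !f0.
- by rewrite cell_ratio_refl // /cell_ratio !fc; field; rewrite !f0 k0.
Qed.

Theorem theorem8 (R : realType) (eta sigma : int) (N : nat)
    (delta epsilon : R) (Gamma T S : 'M[R[i]]_N.*2.+2)
    (Cplus : 'cV[R[i]]_N.*2.+2)
    (eta_pm1 : eta = 1 \/ eta = -1)
    (sigma_pm1 : sigma = 1 \/ sigma = -1)
    (Gamma_jordan : jordan_form Gamma)
    (GammaT : Gamma *m T + sigma%:~R *: (T *m entry_conj Gamma) = 0)
    (TTconj : T *m entry_conj T =
       if sigma == 1 then - (eta%:~R)%:M
       else (eta%:~R * \det (expmx (entry_conj Gamma)) ^+ 2)%:M)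
    (* well-definedness of g, of coth Gamma and of the matrix quotient *)
    (epsilon_neq0 : epsilon != 0)
    (coth_def : expmx (Gamma *+ 2) - 1 \in unitmx)
    (num_unit : 4%:M + (delta * epsilon)%:C *: cothmx Gamma \in unitmx)
    (den_unit : 4%:M - (delta * epsilon)%:C *: cothmx Gamma \in unitmx)
    (* the square root entering the power m/2 *)
    (S_sqrt : principal_sqrtmx (dispersion delta epsilon Gamma) S)
    (cut : sigma = -1 -> forall a : R[i],
       eigenvalue (dispersion delta epsilon Gamma) a -> ~~ (a < 0)) :
  let Phi := phi_vec Gamma S Cplus in
  let Psi := fun n m => T *m entry_conj (Phi (sigma * n) (sigma * m)) in
  let f := fun n m => casoratian N.+1 Gamma (Phi n m) (Psi n m) in
  let g := fun n m =>
    (epsilon%:C)^-1 * casoratian N.+2 Gamma (Phi n m) (Psi n m) in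
  let u := fun n m => g n m / f n m in
  let w := cell_ratio f in
  (forall n m, f n m != 0) ->
  discrete_sine_gordon eta sigma delta epsilon u w.
Proof.
move=> Phi Psi f g u w fn0.
pose E := expmx Gamma; have Eu : E \is a GRing.unit := expmx_unit Gamma.
set de := (delta * epsilon)%:C in num_unit den_unit.
pose p := 4 + de; pose q := 4 - de.
pose P := p *: E - q *: E^-1; pose Q := q *: E - p *: E^-1.
have Pu : P \is a GRing.unit := dispersion_num_unit coth_def num_unit.
have Qu : Q \is a GRing.unit := dispersion_den_unit coth_def den_unit.
have pR : p^* = p.
  have -> : p = (4 + delta * epsilon)%:C by rewrite rmorphD rmorph_nat.
  exact: conjc_real.
have qR : q^* = q.
  have -> : q = (4 - delta * epsilon)%:C by rewrite rmorphB rmorph_nat.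
  exact: conjc_real.
have [SS Sp] := S_sqrt.
have SQ : S *m (S *m Q) = P by rewrite mulmxA SS; exact: dispersionE coth_def den_unit.
have Su : S \is a GRing.unit.
  by have : P \in unitmx := Pu; rewrite -SQ unitmx_mul => /andP[].
have cSE : GRing.comm S E.
  apply: sqrtmx_comm => //; rewrite -[S * S]/(S *m S) SS.
  exact: dispersion_comm coth_def den_unit.
have TE := conj_expmx_intertwine sigma_pm1 GammaT; rewrite -/E in TE.
have TS : T *m entry_conj S = S ^ (- sigma) *m T.
  apply: (conj_sqrtmx_intertwine Eu Su Qu pR qR _ Sp sigma_pm1 TE).
    by rewrite -[LHS]mulrA; exact: SQ.
  by move=> /cut; rewrite -SS.
have [tau [tau0 TT tauE]] : exists tau : R[i], [/\ tau != 0, T *m entry_conj T = tau%:M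
    & if sigma == 1 then tau = - eta%:~R else tau = eta%:~R * \det E ^+ 2].
  have eta0 : eta%:~R != 0 :> R[i] by rewrite intr_eq0; case: eta_pm1 => ->.
  have Ed : \det E != 0.
    by have : E \in unitmx := Eu; rewrite unitmxE unitfE.
  have cEd : \det (entry_conj E) != 0 by rewrite det_map_mx fmorph_eq0.
  rewrite -/E expmx_conj -/E in TTconj.
  case: eqP TTconj => [_ ->|sn1 TTn].
    by exists (- eta%:~R); rewrite oppr_eq0 raddfN.
  have tn0 : eta%:~R * \det (entry_conj E) ^+ 2 != 0 by rewrite mulf_neq0 ?expf_neq0.
  exists (eta%:~R * \det (entry_conj E) ^+ 2); split => //.
  have Td : \det T != 0.
    apply: contraNneq tn0 => T0; have := congr1 (@determinant _ _) TTn.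
    by rewrite det_mulmx T0 mul0r det_scalar => /esym/eqP; rewrite expf_eq0 => /andP[].
  have s1 : sigma = -1 by case: sigma_pm1.
  (* For [sigma = -1] the invertible [T] intertwines [E] with its conjugate, so the determinant of
     the conjugate, which [TTconj] provides, equals [\det E]. *)
  have := congr1 (@determinant _ _) TE; rewrite s1 opprK expr1z !det_mulmx mulrC.
  by move=> /(mulIf Td) ->.
have Tu : T \is a GRing.unit.
  have : (tau%:M : 'M[R[i]]_N.*2.+2) \in unitmx.
    by rewrite unitmxE det_scalar unitfE expf_neq0.
  by rewrite -TT unitmx_mul => /andP[].
have PhiE a b : Phi a b = phi E S Cplus a b.
  by rewrite /Phi /phi_vec expmxMz /phi mulmxA.
have PsiE a b : Psi a b = psi E S T Cplus sigma a b by rewrite /Psi PhiE.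
pose F k a b := cas E k (phi E S Cplus a b) (psi E S T Cplus sigma a b).
have l1 : (N.+1 <= N.*2.+2)%N by rewrite ltnS leqW // -addnn leq_addr.
have l2 : (N.+2 <= N.*2.+2)%N by rewrite !ltnS -addnn leq_addr.
have fE : f = F N.+1.
  by apply/funext => a; apply/funext => b; rewrite /f PhiE PsiE (casoratianE _ _ _ l1).
have uE : u = fun a b => (epsilon%:C)^-1 * F N.+2 a b / F N.+1 a b.
  apply/funext => a; apply/funext => b.
  by rewrite /u /g fE PhiE PsiE (casoratianE _ _ _ l2).
have [k k0 kE] := cas_conj_refl Cplus Eu Su sigma_pm1 TE TT Tu tau0 eta_pm1 tauE.
rewrite /w uE fE; rewrite fE in fn0.
apply: (sine_gordon_of_bilinear (h := F N) eta_pm1 sigma_pm1 epsilon_neq0 k0 fn0) => a b.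
- exact: (cas_toda_lattice Cplus Eu Su sigma_pm1 TE TS a b).
- exact: (cas_bilinear_lattice Cplus Eu Su cSE sigma_pm1 TE TS a b Pu SQ).
- by have [] := kE a b.
- by have [] := kE a b.
Qed.
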